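(* There is no unbranched nonlinear null curve $g:\mathbb{P}^1\to\mathbb{Q}^3$ of degree $7$.
   Context: $\langle\,,\rangle$ is a nondegenerate symmetric complex bilinear form on a $5$-dimensional complex vector space $W$, and $\mathbb{Q}^3=\{[w]\in\mathbb{P}(W):\langle w,w\rangle=0\}\subset\mathbb{P}(W)\simeq\mathbb{P}^4$ is the corresponding smooth quadric (all choices are linearly equivalent). Curves are holomorphic maps. A holomorphic curve $g:S\to\mathbb{Q}^3$ from a connected Riemann surface $S$ is a null curve if its tangent lines lie in $\mathbb{Q}^3$; equivalently, for local holomorphic nonvanishing lifts $G$ with $g=[G]$, one has $\langle G,G\rangle=\langle G,dG\rangle=\langle dG,dG\rangle=0$. It is nonlinear if its image is not contained in a linear $\mathbb{P}^1\subset\mathbb{P}(W)$. It is unbranched if it is an immersion. For compact $S$, the degree of a nonconstant $g$ is its degree as a map to $\mathbb{P}^4$: the number of points, counted with multiplicity, of the preimage of a hyperplane not containing the image. *)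

(* Defs.v *)
From HB Require Import structures.
From mathcomp Require Import all_boot all_order all_algebra.
From mathcomp Require Import all_classical all_reals all_analysis.
From mathcomp Require Import complex.

Set Implicit Arguments.
Unset Strict Implicit.
Unset Printing Implicit Defensive.

Import Order.TTheory GRing.Theory Num.Theory.
Import numFieldNormedType.Exports.

Local Open Scope classical_set_scope.
Local Open Scope ring_scope.

(* Packing R[i] as a numClosedFieldType is what lets the topological and normed
   structures of a numFieldType be inferred on it; the complex derivative of
   F : cplx R -> V at z is then [derive1 F z], and complex differentiability at
   z is [derivable F z 1]. *)
Definition cplx (R : realType) : numClosedFieldType := R[i].

Definition proj (K : fieldType) (V : vectType K) : choiceType :=
  {L : {vspace V} | \dim L == 1%N}.

Definition line (K : fieldType) (V : vectType K) (p : proj V) : {vspace V} :=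
  sval p.

Definition P1 (R : realType) : choiceType := proj 'rV[cplx R]_2.

Definition PW (R : realType) : choiceType := proj 'rV[cplx R]_5.

Section Curves.
Variable R : realType.
Local Notation C := (cplx R).

(* Homogeneous coordinates of the two standard affine charts of P^1:
   (1, z) for i = 0 and (z, 1) for i = 1. *)
Definition chart_vec (i : 'I_2) (z : C) : 'rV[C]_2 :=
  \row_(j < 2) (if j == i then 1 else z).

Lemma chart_vec_dim (i : 'I_2) (z : C) : \dim <[chart_vec i z]>%VS == 1%N.
Proof.
rewrite dim_vline; suff -> : chart_vec i z != 0 by [].
by apply/eqP => /rowP/(_ i)/eqP; rewrite !mxE eqxx oner_eq0.
Qed.

Definition chart (i : 'I_2) (z : C) : P1 R :=
  exist _ <[chart_vec i z]>%VS (chart_vec_dim i z).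

Definition holo_at (V : normedModType C) (F : C -> V) (z0 : C) : Prop :=
  \forall z \near z0, derivable F z 1.

(* G is a holomorphic nonvanishing lift of g near the point z0 of the chart i. *)
Definition local_lift (g : P1 R -> PW R) (i : 'I_2) (z0 : C)
    (G : C -> 'rV[C]_5) : Prop :=
  holo_at G z0 /\
  (\forall z \near z0, G z != 0 /\ line (g (chart i z)) = <[G z]>%VS).

Definition holomorphic_curve (g : P1 R -> PW R) : Prop :=
  forall (i : 'I_2) (z0 : C), exists G, local_lift g i z0 G.

Definition quadric (b : {symmetric 'rV[C]_5}) : set (PW R) :=
  [set p | forall w, w \in line p -> b w w = 0].

Definition null_curve (b : {symmetric 'rV[C]_5}) (g : P1 R -> PW R) : Prop :=
  [/\ holomorphic_curve g,
      forall p, quadric b (g p) &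
      forall (i : 'I_2) (z0 : C) (G : C -> 'rV[C]_5), local_lift g i z0 G ->
        [/\ b (G z0) (G z0) = 0,
            b (G z0) (derive1 G z0) = 0 &
            b (derive1 G z0) (derive1 G z0) = 0]].

Definition nonlinear (g : P1 R -> PW R) : Prop :=
  ~ exists2 L : {vspace 'rV[C]_5}, \dim L = 2%N &
      forall p, (line (g p) <= L)%VS.

(* A nonzero column c is a linear form w |-> w *m c.  The affine chart of P(W)
   off the hyperplane c = 0 is the affine space {w | w *m c = 1}, so a lift G
   normalized by G *m c = 1 is g read in this chart, and g is immersive at the
   point when the derivative of that local expression does not vanish. *)
Definition unbranched (g : P1 R -> PW R) : Prop :=
  forall (i : 'I_2) (z0 : C), exists (c : 'cV[C]_5) (G : C -> 'rV[C]_5),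
    [/\ local_lift g i z0 G,
        \forall z \near z0, G z *m c = 1%:M &
        derive1 G z0 != 0].

Definition in_hyperplane (c : 'cV[C]_5) (q : PW R) : Prop :=
  forall w, w \in line q -> w *m c = 0.

(* The multiplicity of p in the preimage of the hyperplane c = 0 is the order
   of vanishing at p of the linear form c composed with a local lift. *)
Definition multiplicity (g : P1 R -> PW R) (c : 'cV[C]_5) (p : P1 R) (m : nat)
    : Prop :=
  exists (i : 'I_2) (z0 : C) (G : C -> 'rV[C]_5) (h : C -> C),
    [/\ p = chart i z0, local_lift g i z0 G, holo_at h z0, h z0 != 0 &
        \forall z \near z0, (G z *m c) 0 0 = (z - z0) ^+ m * h z].

(* The count does not depend on the hyperplane. *)
Definition has_degree (g : P1 R -> PW R) (d : nat) : Prop :=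
  exists c : 'cV[C]_5,
    [/\ c != 0,
        ~ (forall p, in_hyperplane c (g p)) &
        exists (s : seq (P1 R)) (m : P1 R -> nat),
          [/\ uniq s,
              forall p, p \in s <-> in_hyperplane c (g p),
              forall p, p \in s -> multiplicity g c p (m p) &
              (\sum_(p <- s) m p)%N = d]].

End Curves.

(* Main.v *)
Require Import Defs.
From HB Require Import structures.
From mathcomp Require Import all_boot all_order all_algebra.
From mathcomp Require Import all_classical all_reals all_analysis.
From mathcomp Require Import complex ring lra zify.
Import Order.TTheory GRing.Theory Num.Theory.
Import numFieldNormedType.Exports.
Local Open Scope ring_scope.

Set Implicit Arguments.
Unset Strict Implicit.
Unset Printing Implicit Defensive.

(** A holomorphic curve of degree 7 lifts to a vector [P] of polynomials of
    degree at most 7: multiplying local lifts normalized by the hyperplane by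
    the polynomial of its intersection divisor gives an entire vector of
    polynomial growth.  (Circle means, obtained from Goursat's lemma, show that
    an entire function tending to 0 is 0; dividing by [z - a] repeatedly treats
    polynomial growth.)

    For a null unbranched [P], put [q = <P'', P''>], a form of degree 6.  The
    tangent line [<P, P'>] is everywhere a maximal isotropic plane, so at a
    root of [q] the vector [P''] lies in that plane.  For a root at 0 this
    yields linear relations between the products [<P_i, P_j>] of the
    coefficients, and a root of order more than two makes all of them 0, so
    that the curve is linear.  Hence [q] has three double roots.  Moving two of
    them to 0 and infinity and using the third one determines the [<P_i, P_j>]
    up to scaling, and then the Gram matrix of [P_0], [P_1], [P_3], [P_4],
    [P_6], [P_7] is invertible, which is impossible in dimension 5. *)

(** * Goursat's lemma and circle means *)

(** Rescaling [P] scales [P''] and adds multiples of [P] and [P'], which span an isotropic plane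
    orthogonal to [P'']; so [q dz^4] takes values in the square of a line bundle of degree 7, and
    [q] has degree 14 - 8 = 6. At a root [P'' = a P + c P'], while the differentiated null relations
    give [<P, P'''> = 0] and [<P', P'''> = - q]; hence [q' = 2 <P'', P'''>] vanishes too and no root
    is simple. The same substitution in [<P'', P''''>] yields one more equation at the third root,
    which separates the last two unknowns [<P_2, P_5>] and [<P_3, P_4>]. Local facts are proved at 0
    and carried elsewhere by translations and by [z -> 1/z], which acts on coefficients as
    [i -> 7 - i]. On the analytic side, holomorphy is mere complex differentiability, without
    continuity of the derivative; this calls for Goursat's bisection. In the coordinates
    [z0 + exp (x + i y)] circles become segments, so rectangles are the only contours. Allowing
    finitely many points of mere continuity lets one divide by [z - a] without a removable
    singularity theorem. *)

Section Goursat.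
Variable R : realType.
Implicit Types (Z P Q p q : R -> R -> R) (x y s t e : R).

(* If [Q] is a primitive of [q] in [y] and [P] one of [p] in [x], then
   [mixed (Q - P)] is the integral of [p dx + q dy] around the rectangle. *)
Definition mixed Z x y s t :=
  Z (x + s) (y + t) - Z x (y + t) - Z (x + s) y + Z x y.

Lemma mixed_quarters Z x y s t :
  mixed Z x y s t =
  mixed Z x y (s / 2) (t / 2) + mixed Z (x + s / 2) y (s / 2) (t / 2)
  + mixed Z x (y + t / 2) (s / 2) (t / 2)
  + mixed Z (x + s / 2) (y + t / 2) (s / 2) (t / 2).
Proof.
rewrite /mixed -!addrA.
have -> : s / 2 + s / 2 = s by field.
have -> : t / 2 + t / 2 = t by field.
ring.
Qed.

Lemma exists_quarter Z x y s t : exists c : R * R,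
  [/\ (c.1 = x) \/ (c.1 = x + s / 2), (c.2 = y) \/ (c.2 = y + t / 2) &
      `|mixed Z x y s t| / 4 <= `|mixed Z c.1 c.2 (s / 2) (t / 2)|].
Proof.
set m := `|mixed Z x y s t| / 4.
have [h1|h1] := leP m `|mixed Z x y (s / 2) (t / 2)|.
  by exists (x, y); split; [left|left|].
have [h2|h2] := leP m `|mixed Z (x + s / 2) y (s / 2) (t / 2)|.
  by exists (x + s / 2, y); split; [right|left|].
have [h3|h3] := leP m `|mixed Z x (y + t / 2) (s / 2) (t / 2)|.
  by exists (x, y + t / 2); split; [left|right|].
exists (x + s / 2, y + t / 2); split; [by right|by right|].
rewrite /= leNgt; apply/negP => h4.
have := mixed_quarters Z x y s t; move/(congr1 Num.norm).
move: h1 h2 h3 h4; rewrite /m.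
move: (mixed Z x y s t) (mixed Z x y (s / 2) (t / 2))
  (mixed Z (x + s / 2) y (s / 2) (t / 2))
    (mixed Z x (y + t / 2) (s / 2) (t / 2))
  (mixed Z (x + s / 2) (y + t / 2) (s / 2) (t / 2)) => a b c d f h1 h2 h3 h4 E.
have := ler_normD (b + c + d) f; have := ler_normD (b + c) d.
have := ler_normD b c; rewrite -E; lra.
Qed.

(** Goursat's bisection: some quarter keeps at least a quarter of the absolute value of [mixed], and
    the local bound [e * (s + t) ^+ 2] is also divided by 4 at each halving. At the point to which
    the quarters shrink, a small [e] gives a contradiction. *)
Lemma mixed_eq0 Z x0 y0 s0 t0 : 0 <= s0 -> 0 <= t0 ->
  (forall x y, x0 <= x <= x0 + s0 -> y0 <= y <= y0 + t0 ->
   forall e, 0 < e -> exists2 d, 0 < d & forall a c s t,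
     0 <= s < d -> 0 <= t < d -> a <= x <= a + s -> c <= y <= c + t ->
     x0 <= a -> a + s <= x0 + s0 -> y0 <= c -> c + t <= y0 + t0 ->
     `|mixed Z a c s t| <= e * (s + t) ^+ 2) ->
  mixed Z x0 y0 s0 t0 = 0.
Proof.
move=> s0_ge0 t0_ge0 loc; apply/eqP; rewrite -normr_eq0 eq_le normr_ge0 andbT.
rewrite leNgt; apply/negP => eta_gt0; set eta := `|_| in eta_gt0.
pose sz n : R * R := (s0 / 2 ^+ n, t0 / 2 ^+ n).
have szS n : sz n.+1 = ((sz n).1 / 2, (sz n).2 / 2).
  by rewrite /sz /= exprSr !invfM !mulrA.
have szE n : sz n = (s0 / 2 ^+ n, t0 / 2 ^+ n) by [].
have sz_ge0 n : 0 <= (sz n).1 /\ 0 <= (sz n).2.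
  by split; rewrite /= divr_ge0 // exprn_ge0.
have sz0 : sz 0%N = (s0, t0) by rewrite szE expr0 !divr1.
clearbody sz.
have /choice[next nextP] :
    forall r : (R * R) * (R * R), exists c : R * R,
    [/\ (c.1 = r.1.1) \/ (c.1 = r.1.1 + r.2.1 / 2),
        (c.2 = r.1.2) \/ (c.2 = r.1.2 + r.2.2 / 2) &
        `|mixed Z r.1.1 r.1.2 r.2.1 r.2.2| / 4
          <= `|mixed Z c.1 c.2 (r.2.1 / 2) (r.2.2 / 2)|].
  by move=> [[x y] [s t]]; exact: exists_quarter.
pose pos := fix pos n := if n is m.+1 then next (pos m, sz m) else (x0, y0).
have nested n m : (n <= m)%N ->
   [/\ (pos n).1 <= (pos m).1, (pos m).1 + (sz m).1 <= (pos n).1 + (sz n).1,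
       (pos n).2 <= (pos m).2 & (pos m).2 + (sz m).2 <= (pos n).2 + (sz n).2].
  elim: m => [|m IH]; first by rewrite leqn0 => /eqP ->.
  rewrite leq_eqVlt => /orP[/eqP -> //|]; rewrite ltnS => /IH[h1 h2 h3 h4].
  have [g1 g2 _] := nextP (pos m, sz m); have [k1 k2] := sz_ge0 m.
  rewrite szS -[pos m.+1]/(next (pos m, sz m));
    move: g1 g2 h1 h2 h3 h4 k1 k2 => /=.
  move: (next _) => c; move: (sz m) => z.
  by case=> ->; case=> ->; split; lra.
have big n : eta / 4 ^+ n <= `|mixed Z (pos n).1 (pos n).2 (sz n).1 (sz n).2|.
  elim: n => [|n IH]; first by rewrite sz0 expr0 divr1.
  have [_ _ /=] := nextP (pos n, sz n); rewrite szS; apply: le_trans.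
  by rewrite exprSr invfM mulrA ler_wpM2r // invr_ge0.
(* [f] stands for either coordinate: the left ends increase and are bounded by every right end, so
   their supremum lies in all the intervals. *)
have lim (f : R * R -> R) : (forall n m, (n <= m)%N ->
     f (pos n) <= f (pos m) /\ f (pos m) + f (sz m) <= f (pos n) + f (sz n)) ->
   (forall n, 0 <= f (sz n)) ->
   exists x, forall n, f (pos n) <= x <= f (pos n) + f (sz n).
  move=> mono f_ge0; pose A := range (fun n => f (pos n)).
  have ubA m : ubound A (f (pos m) + f (sz m)).
    move=> _ [n _ <-]; have [le_nm|lt_mn] := leqP n m.
      have [] := mono _ _ le_nm; have := f_ge0 m; lra.
    have [] := mono _ _ (ltnW lt_mn); have := f_ge0 n; lra.
  exists (sup A) => n; apply/andP; split.
    by apply: ub_le_sup; [exists (f (pos 0) + f (sz 0)); exact: ubA|exists n].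
  by apply: ge_sup; [exists (f (pos 0)); exists 0%N|exact: ubA].
have [|n|x xP] := lim fst; first by move=> n m /nested[].
  by case: (sz_ge0 n).
have [|n|y yP] := lim snd; first by move=> n m /nested[].
  by case: (sz_ge0 n).
pose w := (s0 + t0) ^+ 2; have w_ge0 : 0 <= w by rewrite exprn_even_ge0.
(* [w] is the squared half-perimeter of the initial rectangle, so at stage [n] this [e] bounds
   [mixed] by less than half of [eta / 4 ^+ n]. *)
have e_gt0 : 0 < eta / (2 * (w + 1)).
  by rewrite divr_gt0 // mulr_gt0 // ltr_wpDl.
have [||d d_gt0 dP] := loc x y _ _ _ e_gt0.
- by have := xP 0%N; rewrite sz0.
- by have := yP 0%N; rewrite sz0.
have [n n_big] : exists n, (s0 + t0) / d < 2 ^+ n.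
  have [n hn] : exists n : nat, (s0 + t0) / d < n%:R.
    by exists (Num.truncn ((s0 + t0) / d)).+1; exact: truncnS_gt.
  exists n; apply: (lt_trans hn); rewrite -natrX ltr_nat.
  exact: ltn_expl.
have n2 : 0 < (2 : R) ^+ n by rewrite exprn_gt0.
have small z : 0 <= z -> z <= s0 + t0 -> 0 <= z / 2 ^+ n < d.
  move=> z0 zle; rewrite (divr_ge0 z0 (ltW n2)) /=.
  rewrite (ltr_pdivrMr _ _ n2); apply: le_lt_trans zle _.
  by rewrite mulrC -(ltr_pdivrMr _ _ d_gt0).
have hs : 0 <= (sz n).1 < d by rewrite szE; apply: small; lra.
have ht : 0 <= (sz n).2 < d by rewrite szE; apply: small; lra.
have := nested 0%N n (leq0n n); rewrite sz0 => -[n1 n2' n3 n4].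
have := le_trans (big n) (dP _ _ _ _ hs ht (xP n) (yP n) n1 n2' n3 n4).
have -> : ((sz n).1 + (sz n).2) ^+ 2 = w / 4 ^+ n.
  rewrite szE /w /= -mulrDl exprMn exprVn -exprM mulnC exprM.
  by have -> : (2 : R) ^+ 2 = 4 by ring.
rewrite mulrA ler_pM2r ?invr_gt0 ?exprn_gt0 // mulrAC ler_pdivlMr; last lra.
have : 0 <= eta * w by rewrite mulr_ge0 // ltW.
lra.
Qed.
End Goursat.

(** * Edge estimates for closed forms *)

Section Rectangles.
Variable R : realType.
Implicit Types (P Q p q : R -> R -> R) (x y s t e : R).

Lemma increment_le (f f' : R -> R) (a b B : R) : a <= b ->
  (forall x, a <= x <= b -> is_derive x 1 f (f' x)) ->
  (forall x, a <= x <= b -> `|f' x| <= B) -> `|f b - f a| <= B * (b - a).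
Proof.
move=> ab df f'B.
have [||c] := @MVT_segment R f f' a b ab.
- by move=> x; rewrite in_itv /= => /andP[h1 h2]; apply: df; rewrite !ltW.
- apply: derivable_within_continuous => x; rewrite in_itv /= => xab.
  by have [] := df x xab.
rewrite in_itv /= => cab ->; rewrite normrM (ger0_norm (x := b - a)) ?subr_ge0
  //.
by rewrite ler_wpM2r ?subr_ge0 // f'B.
Qed.

Lemma increment_eq (f g h : R -> R) (a b : R) : a <= b ->
  (forall x, a <= x <= b -> is_derive x 1 f (h x)) ->
  (forall x, a <= x <= b -> is_derive x 1 g (h x)) -> f b - f a = g b - g a.
Proof.
move=> ab df dg; apply/eqP; rewrite -subr_eq0 -normr_le0.
have := @increment_le (f - g) (fun=> 0) a b 0 ab.
rewrite mul0r (_ : (f - g) b - (f - g) a = f b - f a - (g b - g a)); last first.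
  by rewrite -[(f - g) b]/(f b - g b) -[(f - g) a]/(f a - g a); ring.
apply => [x xab|x _]; last by rewrite normr0.
rewrite -(subrr (h x)); have := df x xab; have := dg x xab => d1 d2.
exact: is_deriveB.
Qed.

(* First-order form, at a point, of the closedness of [p dx + q dy]. *)
Definition closed_at p q x y := exists b c d : R, forall e, 0 < e ->
  exists2 r, 0 < r & forall x' y', `|x' - x| < r -> `|y' - y| < r ->
    `|p x' y' - p x y - (b * (x' - x) + c * (y' - y))|
       <= e * (`|x' - x| + `|y' - y|) /\
    `|q x' y' - q x y - (c * (x' - x) + d * (y' - y))|
       <= e * (`|x' - x| + `|y' - y|).

(** The linear parts of [q] on the two vertical edges differ by exactly [c * s]. Hence the increment
    of [Q] between the edges, minus [c * s] times the height, has derivative at most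
    [2 * e * (s + t)], and the mean value inequality applies. *)
Lemma edge_le (q : R -> R -> R) (Q : R -> R -> R) x y c d e r a b s t :
  (forall x' y', `|x' - x| < r -> `|y' - y| < r ->
    `|q x' y' - q x y - (c * (x' - x) + d * (y' - y))|
       <= e * (`|x' - x| + `|y' - y|)) ->
  0 <= e -> 0 <= s < r -> 0 <= t < r -> a <= x <= a + s -> b <= y <= b + t ->
  (forall y', b <= y' <= b + t -> is_derive y' 1 (Q a) (q a y')) ->
  (forall y', b <= y' <= b + t -> is_derive y' 1 (Q (a + s)) (q (a + s) y')) ->
  `|mixed Q a b s t - c * s * t| <= 2 * e * (s + t) * t.
Proof.
move=> h e0 /andP[s0 sr] /andP[t0 tr] /andP[ax xa] /andP[hb yb] dQa dQs.
pose f : R -> R := (Q (a + s) - Q a) - (fun z => c * s * z).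
have -> : mixed Q a b s t - c * s * t = f (b + t) - f b.
  by rewrite /f /mixed !fctE; ring.
rewrite [X in _ <= _ * X](_ : t = b + t - b); last by ring.
apply: (@increment_le f (fun y' => q (a + s) y' - q a y' - c * s * 1)).
- lra.
- move=> z hz; have d1 := dQa z hz; have d2 := dQs z hz.
  have d3 : is_derive z 1 (fun z => c * s * z) (c * s * 1).
    exact: is_deriveZ.
  exact: is_deriveB.
move=> z /andP[bz zb].
have zr : `|z - y| <= t by rewrite ler_norml; apply/andP; split; lra.
have ar : `|a - x| <= s by rewrite ler_norml; apply/andP; split; lra.
have sr' : `|a + s - x| <= s by rewrite ler_norml; apply/andP; split; lra.
have := h (a + s) z (le_lt_trans sr' sr) (le_lt_trans zr tr).
have g1 : e * (`|a - x| + `|z - y|) <= e * (s + t) by rewrite ler_wpM2l // lerD.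
have g2 : e * (`|a + s - x| + `|z - y|) <= e * (s + t).
  by rewrite ler_wpM2l // lerD.
move/le_trans/(_ g2); have {g1} := le_trans
  (h a z (le_lt_trans ar sr) (le_lt_trans zr tr)) g1.
rewrite !ler_norml => /andP[k1 k2] /andP[k3 k4].
have E1 : c * (a + s - x) + d * (z - y) - (c * (a - x) + d * (z - y)) = c * s.
  by ring.
by apply/andP; split; lra.
Qed.
End Rectangles.

(** * Rectangle integrals and circle means *)

Section CircleMeans.
Variable R : realType.
Implicit Types (P Q p q u v : R -> R -> R) (x y s t e : R).

(** The cross coefficient [c] in [closed_at] is common to [p] and [q], so the main terms [c * s * t]
    of the two edge estimates cancel. *)
Lemma goursat p q P Q x0 y0 s0 t0 : 0 <= s0 -> 0 <= t0 ->
  (forall x y, x0 <= x <= x0 + s0 -> y0 <= y <= y0 + t0 ->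
    [/\ is_derive y 1 (Q x) (q x y), is_derive x 1 (P^~ y) (p x y) &
        closed_at p q x y]) ->
  mixed Q x0 y0 s0 t0 = mixed P x0 y0 s0 t0.
Proof.
move=> s0_ge0 t0_ge0 H; pose Z x y := Q x y - P x y.
suff : mixed Z x0 y0 s0 t0 = 0 by rewrite /mixed /Z; lra.
apply: mixed_eq0 => // x y xP yP e e0.
have [_ _ [b [c [d hd]]]] := H x y xP yP.
(* With [e / 4] the two edge estimates add up to [e * (s + t) ^+ 2 / 2]. *)
have [|r r0 h] := hd (e / 4); first by rewrite divr_gt0.
exists r => // a b' s t sr tr ax by' xa as0 yb bt0.
have e4 : 0 <= e / 4 by rewrite divr_ge0 // ltW.
have st : 0 <= s /\ 0 <= t by lra.
have h1 : `|mixed Q a b' s t - c * s * t| <= 2 * (e / 4) * (s + t) * t.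
  apply: (@edge_le R q Q x y c d (e / 4) r) => //.
  - by move=> x' y' h1 h2; have [] := h x' y' h1 h2.
  - by move=> y' y'P; have [||//] := H a y'; lra.
  - by move=> y' y'P; have [||//] := H (a + s) y'; lra.
have h2 : `|mixed (fun y x => P x y) b' a t s - c * t * s|
    <= 2 * (e / 4) * (t + s) * s.
  apply: (@edge_le R (fun y x => p x y) _ y x c b (e / 4) r) => //.
  - move=> y' x' h2 h3; have [+ _] := h x' y' h3 h2.
    by rewrite (addrC `|y' - y|) (addrC (c * _)).
  - by move=> x' x'P; have [||//] := H x' b'; lra.
  - by move=> x' x'P; have [||//] := H x' (b' + t); lra.
move: h1 h2; have -> : mixed Z a b' s t =
  mixed Q a b' s t - c * s * t - (mixed (fun y x => P x y) b' a t s - c * t *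
    s).
  by rewrite /mixed /Z; ring.
have st2 : (2 * (e / 4) * (s + t) * t) + (2 * (e / 4) * (t + s) * s) <= e *
  (s + t) ^+ 2.
  rewrite (_ : _ + _ = e * (s + t) ^+ 2 / 2); last by field.
  have : 0 <= e * (s + t) ^+ 2 by rewrite mulr_ge0 ?exprn_even_ge0 // ltW.
  lra.
move=> h1 h2; apply: le_trans (ler_normB _ _) _.
by apply: le_trans st2; apply: lerD.
Qed.

Lemma exists_primitive (f : R -> R) (A B : R) : A < B -> continuous f ->
  exists F : R -> R, forall x, A < x < B -> is_derive x 1 F (f x).
Proof.
move=> AB cf; exists (fun x => \int[lebesgue_measure]_(t in `[A, x]) f t) => x
  /andP[Ax xB].
have [|d e] := @continuous_FTC1_closed R f A x B xB _ Ax (cf x).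
  apply: continuous_compact_integrable; first exact: segment_compact.
  exact: continuous_subspaceT.
by rewrite -e derive1E; apply: derivableP.
Qed.

Definition jointly_continuous u := forall x y e, 0 < e ->
  exists2 r, 0 < r & forall x' y', `|x' - x| < r -> `|y' - y| < r ->
    `|u x' y' - u x y| <= e.

Lemma jointly_continuous_slice u x : jointly_continuous u -> continuous (u x).
Proof.
move=> cu y; apply/cvgrPdist_le => e /(cu x y)[r r0 h].
near=> y'; rewrite distrC; apply: h; first by rewrite subrr normr0.
rewrite distrC; near: y'; exact: cvgr_dist_lt.
Unshelve. all: by end_near. Qed.

Lemma jointly_continuous_slice2 u y : jointly_continuous u ->
  continuous (u^~ y).
Proof.
by move=> cu; apply: (@jointly_continuous_slice (fun a b => u b a)) => a b e
  /(cu b a)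
  [r r0 h]; exists r => // x' y' h1 h2; apply: h.
Qed.

Lemma uniform_slices u x0 T e : jointly_continuous u -> 0 < e ->
  exists2 r, 0 < r & forall x y, `|x - x0| < r -> 0 <= y <= T ->
    `|u x y - u x0 y| <= e.
Proof.
move=> cu e0.
have /compact_near_coveringP K := @segment_compact R 0 T.
have : \forall x \near x0, (`[0, T]%classic `<=`
  (fun y => `|u x y - u x0 y| <= e))%classic.
  refine (K _ (nbhs x0) (fun x y => `|u x y - u x0 y| <= e) _ _).
  move=> y _; have [|r r0 h] := cu x0 y (e / 2); first by rewrite divr_gt0.
  near=> y' x.
  have h1 : `|y' - y| < r by rewrite distrC; near: y'; exact: cvgr_dist_lt.
  have h2 : `|x - x0| < r by rewrite distrC; near: x; exact: cvgr_dist_lt.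
  have h3 := h x y' h2 h1; have h4 : `|x0 - x0| < r by rewrite subrr normr0.
  have := h x0 y' h4 h1; move: h3; rewrite !ler_norml => /andP[] h3 h5 /andP[]
    h6 h7.
  by apply/andP; split; lra.
move=> /nbhs_ballP[r /= r0 h]; exists r => // x y xr yT.
by apply: (h x); [rewrite /ball /= distrC|rewrite /= in_itv].
Unshelve. all: by end_near. Qed.

(** Exceptional values are removed one at a time: an interval through [z] is cut shortly before and
    shortly after [z], and continuity at [z] joins the two pieces. *)
Lemma locally_constant_off (E : seq R) (M : R -> R) :
  (forall x e, 0 < e -> exists2 r, 0 < r & forall x', `|x' - x| < r ->
     `|M x' - M x| <= e) ->
  (forall x y, x <= y -> (forall z, x <= z <= y -> z \notin E) -> M x = M y) ->
  forall x y, M x = M y.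
Proof.
move=> cM; elim: E => [|z E IH] h x y.
  have [xy|yx] := leP x y; first by apply: h.
  by apply/esym/h => //; rewrite ltW.
apply: IH => {}x {}y xy xyE.
have [zxy|/negP zxy] := boolP (x <= z <= y); last first.
  apply: h => // t xty; rewrite inE negb_or xyE // andbT.
  by apply/eqP => tz; apply: zxy; rewrite -tz.
have reach e : 0 < e -> `|M x - M z| <= e /\ `|M y - M z| <= e.
  move=> e0; have [r r0 hr] := cM z e e0; move/andP: zxy => [xz zy]; split.
    have [->|xNz] := eqVneq x z; first by rewrite subrr normr0 ltW.
    have x_lt : x < z by rewrite lt_neqAle xNz.
    (* A point from [x] on, strictly before [z] and within [r] of it; the interval from [x] to it
       avoids [z]. *)
    pose x' := Num.max x (z - r / 2).
    have [hx hx' hx''] : [/\ x <= x', x' < z & z - r / 2 <= x'].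
      by rewrite /x' le_max lexx gt_max le_max lexx orbT x_lt; split=> //; lra.
    rewrite (h x x' hx); first by apply: hr; rewrite ltr_norml; apply/andP;
      split; lra.
    move=> t /andP[xt tx']; rewrite inE negb_or xyE; last by lra.
    by rewrite andbT; apply/eqP => tz; move: tx'; rewrite tz leNgt hx'.
  have [->|yNz] := eqVneq y z; first by rewrite subrr normr0 ltW.
  have y_gt : z < y by rewrite lt_neqAle eq_sym yNz.
  pose y' := Num.min y (z + r / 2).
  have [hy hy' hy''] : [/\ y' <= y, z < y' & y' <= z + r / 2].
    by rewrite /y' ge_min lexx lt_min ge_min lexx orbT y_gt; split=> //; lra.
  rewrite -(h y' y hy); first by apply: hr; rewrite ltr_norml; apply/andP;
    split; lra.
  move=> t /andP[yt ty']; rewrite inE negb_or xyE; last by lra.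
  by rewrite andbT; apply/eqP => tz; move: yt; rewrite tz leNgt hy'.
have eq0 (a : R) : (forall e, 0 < e -> `|a| <= e) -> a = 0.
  move=> ha; apply/eqP; rewrite -normr_eq0 eq_le normr_ge0 andbT leNgt.
  by apply/negP => a0; have := ha (`|a| / 2); lra.
have /eqP : M x - M z = 0 by apply: eq0 => e /reach[].
have /eqP : M y - M z = 0 by apply: eq0 => e /reach[].
by rewrite !subr_eq0 => /eqP -> /eqP.
Qed.

(* [u + iv] is a holomorphic function in logarithmic polar coordinates, and [E]
   lists the radii of the points where it is only known to be continuous. *)
Lemma circle_mean_eq u v (T L L' : R) (E : seq R) : 0 < T ->
  jointly_continuous u -> jointly_continuous v ->
  (forall x, v x 0 = v x T) ->
  (forall x y, x \notin E -> closed_at v u x y) ->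
  (forall e, 0 < e -> exists x, forall y, `|u x y - L| <= e) ->
  (forall e, 0 < e -> exists x, forall y, `|u x y - L'| <= e) ->
  L = L'.
Proof.
move=> T0 cu cv per cl lim1 lim2.
have /choice[Q dQ] : forall x, exists F : R -> R, forall y, -1 < y < T + 1 ->
    is_derive y 1 F (u x y).
  move=> x; apply: exists_primitive; first lra.
  exact: jointly_continuous_slice.
(* [M x] is the integral of [u x] from 0 to [T], that is [T] times the mean over the circle of
   logarithmic radius [x]. *)
pose M x := Q x T - Q x 0.
have near_M x c e : (forall y, 0 <= y <= T -> `|u x y - c| <= e) ->
  `|M x - c * T| <= e * T.
  move=> h.
  have := @increment_le R (Q x - (fun y => c * y)) (fun y => u x y - c * 1) 0 T
    e (ltW T0).
  rewrite !fctE mulr0 subr0 /M (_ : Q x T - c * T - Q x 0 =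
    Q x T - Q x 0 - c * T); last by ring.
  rewrite subr0; apply => [y yT|y yT].
    have d1 : is_derive y 1 (Q x) (u x y) by apply: dQ; lra.
    have d3 : is_derive y 1 (fun z => c * z) (c * 1) by exact: is_deriveZ.
    exact: is_deriveB.
  by rewrite mulr1; apply: h.
have M_const x y : M x = M y.
  apply: (locally_constant_off (E := E)) => {x y} [x e e0|x y xy xyE].
    have [r r0 h] := @uniform_slices u x T (e / T) cu (divr_gt0 e0 T0).
    exists r => // x' x'r.
    have := @increment_le R (Q x' - Q x) (fun y => u x' y - u x y) 0 T (e / T)
      (ltW T0).
    rewrite !fctE /M subr0 divfK ?gt_eqF //.
    rewrite (_ : Q x' T - Q x T - _ = Q x' T - Q x' 0 - (Q x T - Q x 0));
      last by ring.
    apply => [z zT|z zT]; last exact: h.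
    have d1 : is_derive z 1 (Q x) (u x z) by apply: dQ; lra.
    have d2 : is_derive z 1 (Q x') (u x' z) by apply: dQ; lra.
    exact: is_deriveB.
  have /choice[P dP] : forall z, exists F : R ->
    R, forall t, x - 1 < t < y + 1 ->
      is_derive t 1 F (v t z).
    move=> z; apply: exists_primitive; first lra.
    exact: jointly_continuous_slice2.
  have H : mixed Q x 0 (y - x) T = mixed (fun a b => P b a) x 0 (y - x) T.
    apply: (@goursat v u) => [||a b]; [lra|lra|].
    rewrite subrKC add0r => aP bP; split; last by apply/cl/xyE.
      by apply: dQ; lra.
    by apply: dP; lra.
  (* By [per] the edges at angles 0 and [T] carry the same integrand, so they cancel in Goursat's
     identity and only the two circles remain. *)
  have e1 : P T y - P T x = P 0 y - P 0 x.
    apply: (@increment_eq R _ _ (fun t => v t 0)) => // t xty;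
      last by apply: dP; lra.
    by rewrite per; apply: dP; lra.
  by move: H; rewrite /mixed /M subrKC add0r; lra.
have small e : 0 < e -> `|L - L'| <= 2 * e.
  move=> e0; have [x xP] := lim1 e e0; have [y yP] := lim2 e e0.
  have := near_M x L e (fun y _ => xP y); have :=
    near_M y L' e (fun y _ => yP y).
  rewrite (M_const x y) => h1 h2.
  have : `|L - L'| * T <= (2 * e) * T.
    rewrite -{1}(ger0_norm (ltW T0)) -normrM ler_norml.
    by move: h1 h2; rewrite !ler_norml => /andP[? ?] /andP[? ?]; apply/andP;
      split; lra.
  by rewrite ler_pM2r.
apply/eqP; rewrite -subr_eq0 -normr_eq0 eq_le normr_ge0 andbT leNgt.
by apply/negP => a0; have := small (`|L - L'| / 4); lra.
Qed.
End CircleMeans.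

(** * Entire functions of polynomial growth *)

Section Modulus.
Variable R : realType.
Local Notation C := (cplx R).
Implicit Types z w : C.

Definition cof (x : R) : C := (x%:C)%C.

(** The norm of [cplx R] takes its values in [cplx R]; estimates, suprema and logarithms need the
    modulus as an element of [R]. *)
Definition nrm z : R := complex.Re (`|z| : R[i]).

Lemma nrmE z : `|z| = cof (nrm z).
Proof. by rewrite /nrm /cof [`|z|](@normc_def R). Qed.

Lemma cof_le (x y : R) : (cof x <= cof y) = (x <= y).
Proof. exact: lecR. Qed.

Lemma cof_lt (x y : R) : (cof x < cof y) = (x < y).
Proof. exact: ltcR. Qed.

Lemma cofD (x y : R) : cof (x + y) = cof x + cof y.
Proof. exact: rmorphD. Qed.

Lemma cofM (x y : R) : cof (x * y) = cof x * cof y.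
Proof. exact: rmorphM. Qed.

Lemma cof_inj : injective cof.
Proof. by move=> x y []. Qed.

Lemma cof0 : cof 0 = 0. Proof. by []. Qed.

Lemma nrm_ge0 z : 0 <= nrm z.
Proof. by rewrite -cof_le -nrmE cof0 normr_ge0. Qed.

Lemma nrmM z w : nrm (z * w) = nrm z * nrm w.
Proof. by apply: cof_inj; rewrite cofM -!nrmE normrM. Qed.

Lemma nrmD z w : nrm (z + w) <= nrm z + nrm w.
Proof. by rewrite -cof_le cofD -!nrmE ler_normD. Qed.

Lemma nrmN z : nrm (- z) = nrm z.
Proof. by apply: cof_inj; rewrite -!nrmE normrN. Qed.

Lemma nrmV z : nrm z^-1 = (nrm z)^-1.
Proof. by apply: cof_inj; rewrite -nrmE normfV nrmE /cof fmorphV. Qed.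

Lemma nrmX z n : nrm (z ^+ n) = nrm z ^+ n.
Proof. by apply: cof_inj; rewrite -nrmE normrX nrmE /cof rmorphXn. Qed.

Lemma nrm0 : nrm 0 = 0. Proof. by apply: cof_inj; rewrite -nrmE normr0. Qed.

Lemma nrm_eq0 z : (nrm z == 0) = (z == 0).
Proof. by rewrite -(inj_eq cof_inj) -nrmE cof0 normr_eq0. Qed.

Lemma nrm_gt0 z : (0 < nrm z) = (z != 0).
Proof. by rewrite lt_def nrm_ge0 andbT nrm_eq0. Qed.

Lemma Re_le_nrm z : `|complex.Re z| <= nrm z.
Proof. by rewrite -cof_le -nrmE; exact: normc_ge_Re. Qed.

Lemma Im_le_nrm z : `|complex.Im z| <= nrm z.
Proof.
have := Re_le_nrm (Complex 0 (-1) * z : C); rewrite nrmM.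
have -> : nrm (Complex 0 (-1) : C) = 1.
  apply: cof_inj; rewrite -nrmE [LHS](@normc_def R) /=.
  by rewrite expr0n /= add0r sqrrN expr1n sqrtr1.
by case: z => a b /=; rewrite mul0r mul1r mulN1r opprK add0r.
Qed.

Lemma nrm_le_ReIm z : nrm z <= `|complex.Re z| + `|complex.Im z|.
Proof.
case: z => a b; have -> : Complex a b = cof a + Complex 0 1 * cof b :> C.
  by rewrite /cof; apply/eqP; rewrite eq_complex /=; apply/andP; split;
    apply/eqP; ring.
apply: le_trans (nrmD _ _) _; rewrite nrmM /=.
have cofn x : nrm (cof x) = `|x|.
  by apply: cof_inj; rewrite -nrmE [LHS](@normc_def R) /= expr0n addr0
    sqrtr_sqr.
have -> : nrm (Complex 0 1 : C) = 1.
  apply: cof_inj; rewrite -nrmE [LHS](@normc_def R) /=.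
  by rewrite expr0n /= add0r expr1n sqrtr1.
by rewrite !cofn mul1r /= !(mul0r, mulr0, addr0, add0r, mul1r, subr0, oppr0).
Qed.

Lemma near_nrm z0 (P : C -> Prop) : (\forall z \near z0, P z) <->
  exists2 r : R, 0 < r & forall z, nrm (z - z0) < r -> P z.
Proof.
split=> [/nbhs_ballP[e /= e0 h]|[r r0 h]].
  have eE : e = cof (nrm e) by rewrite -nrmE gtr0_norm.
  exists (nrm e); first by rewrite -cof_lt -eE.
  move=> z zr; apply: h; rewrite /ball /= distrC nrmE eE cof_lt //.
apply/nbhs_ballP; exists (cof r); first by rewrite /= -cof0 cof_lt.
by move=> z; rewrite /ball /= distrC nrmE cof_lt => /h.
Qed.

Lemma continuous_nrm (F : C -> C) z0 : {for z0, continuous F} <->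
  forall e : R, 0 < e -> exists2 r : R, 0 < r &
    forall z, nrm (z - z0) < r -> nrm (F z - F z0) < e.
Proof.
split=> [cF e e0|h].
  apply/near_nrm; have : nbhs (F z0) [set w | nrm (w - F z0) < e]%classic.
    by apply/near_nrm; exists e.
  exact: cF.
move=> A /near_nrm[e e0 eA]; apply/near_nrm; have [r r0 rP] := h e e0.
by exists r => // z /rP /eA.
Qed.

Lemma derivable_nrm (F : C -> C) z0 : derivable F z0 1 ->
  exists l : C, forall e : R, 0 < e -> exists2 r : R, 0 < r &
    forall z, nrm (z - z0) < r ->
      nrm (F z - F z0 - l * (z - z0)) <= e * nrm (z - z0).
Proof.
move=> /derivable_nbhs /eqaddoP dF; exists ('D_1 F z0) => e e0.
have e0' : 0 < cof e by rewrite -cof0 cof_lt.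
have /near_nrm[r r0 h] := dF _ e0'; exists r => // z zr.
have := h (z - z0); rewrite subr0 => /(_ zr).
rewrite !fctE /= scaler1 subrK [_ *: _]mulrC opprD addrA.
by rewrite !nrmE -cofM cof_le.
Qed.

End Modulus.

Section RealExpansions.
Variable R : realType.

Lemma real_expansion (f : R -> R) (x d : R) : is_derive x 1 f d ->
  forall e, 0 < e -> exists2 r, 0 < r &
    forall h, `|h| < r -> `|f (x + h) - f x - d * h| <= e * `|h|.
Proof.
move=> [/derivable_nbhs /eqaddoP dF df] e e0; rewrite df in dF.
have /nbhs_ballP[r /= r0 h] := dF _ e0; exists r => // t tr.
have := h t; rewrite /ball /= sub0r normrN => /(_ tr).
by rewrite !fctE /= scaler1 [t + x]addrC [_ *: _]mulrC opprD addrA.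
Qed.
End RealExpansions.

(** * Logarithmic polar coordinates and vanishing of decaying entire functions *)

Section PolarCoordinates.
Variable R : realType.
Local Notation C := (cplx R).

(** This is the exponential of [x + i y], so [z0 + cis x y] is the point at distance [expR x] from
    [z0] in direction [y]. *)
Definition cis (x y : R) : C := Complex (expR x * cos y) (expR x * sin y).

Lemma nrm_cis x y : nrm (cis x y) = expR x.
Proof.
apply: cof_inj; rewrite -nrmE [LHS](@normc_def R) /= !exprMn -mulrDr.
by rewrite cos2Dsin2 mulr1 sqrtr_sqr gtr0_norm ?expR_gt0.
Qed.

Lemma cisD x y h k : cis (x + h) (y + k) = cis x y * cis h k.
Proof.
apply/eqP; rewrite eq_complex /= expRD cosD sinD; apply/andP.
by split; apply/eqP; ring.
Qed.

Lemma cis_expansion0 (e : R) : 0 < e -> exists2 r, 0 < r &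
  forall h k, `|h| < r -> `|k| < r ->
    nrm (cis h k - 1 - Complex h k) <= e * (`|h| + `|k|).
Proof.
move=> e0; pose e' := Num.min (e / 8) 1.
have e'0 : 0 < e' by rewrite lt_min ltr01 andbT divr_gt0.
have [e'e e'1] : e' <= e / 8 /\ e' <= 1 by rewrite !ge_min !lexx orbT.
clearbody e'.
have [r1 r10 h1] := real_expansion (is_derive_expR (0 : R)) e'0.
have [r2 r20 h2] := real_expansion (is_derive_cos (0 : R)) e'0.
have [r3 r30 h3] := real_expansion (is_derive_sin (0 : R)) e'0.
exists (Num.min (Num.min r1 r2) (Num.min r3 e')).
  by rewrite !lt_min r10 r20 r30 e'0.
move=> h k; rewrite !lt_min => /andP[/andP[hr1 hr2] /andP[hr3 he]].
move=> /andP[/andP[kr1 kr2] /andP[kr3 ke]].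
have := h1 h hr1; have := h2 k kr2; have := h3 k kr3.
rewrite !add0r expR0 cos0 sin0 !mul1r oppr0 mul0r !subr0 ?addr0.
move: (expR h) (cos k) (sin k) (cis h k) (erefl : cis h k =
  Complex (expR h * cos k) (expR h * sin k)) => E c s _ -> g3 g2 g1.
have E1 : `|E - 1| <= 2 * `|h|.
  rewrite (_ : E - 1 = (E - 1 - h) + h); last by ring.
  apply: le_trans (ler_normD _ _) _; apply: le_trans (lerD g1 (lexx _)) _.
  have : e' * `|h| <= 1 * `|h| by rewrite ler_wpM2r.
  lra.
have E3 : `|E| <= 3.
  rewrite (_ : E = (E - 1) + 1); last by ring.
  by apply: le_trans (ler_normD _ _) _; rewrite normr1; lra.
have A1 : `|E * c - 1 - h| <= e' * `|h| + 3 * (e' * `|k|).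
  rewrite (_ : _ - h = (E - 1 - h) + E * (c - 1)); last by ring.
  apply: le_trans (ler_normD _ _) _; apply: lerD => //.
  by rewrite normrM ler_pM.
have A2 : `|E * s - k| <= 3 * (e' * `|k|) + 2 * (e' * `|k|).
  rewrite (_ : _ - k = E * (s - k) + (E - 1) * k); last by ring.
  apply: le_trans (ler_normD _ _) _; rewrite !normrM; apply: lerD.
    by rewrite ler_pM.
  rewrite mulrA ler_wpM2r // (le_trans E1) // ler_wpM2l //; lra.
apply: le_trans (nrm_le_ReIm _) _ => /=.
rewrite oppr0 addr0; apply: le_trans (lerD A1 A2) _.
have B1 : e' * `|h| <= e / 8 * `|h| by rewrite ler_wpM2r.
have B2 : e' * `|k| <= e / 8 * `|k| by rewrite ler_wpM2r.
have B3 : 0 <= e * `|h| by rewrite mulr_ge0 // ltW.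
lra.
Qed.

Lemma cis_expansion x y (e : R) : 0 < e -> exists2 r, 0 < r &
  forall x' y', `|x' - x| < r -> `|y' - y| < r ->
    nrm (cis x' y' - cis x y - cis x y * Complex (x' - x) (y' - y))
      <= e * (`|x' - x| + `|y' - y|).
Proof.
move=> e0; have [|r r0 h] := @cis_expansion0 (e / expR x).
  by rewrite divr_gt0 // expR_gt0.
exists r => // x' y' /h {}h /h {}h.
have -> : cis x' y' = cis x y * cis (x' - x) (y' - y).
  by rewrite -cisD; congr cis; ring.
set d := Complex _ _ in h *; set c := cis (x' - x) _ in h *.
rewrite (_ : _ - _ - _ = cis x y * (c - 1 - d)); last by ring.
rewrite nrmM nrm_cis.
by rewrite mulrC -ler_pdivlMr ?expR_gt0 // mulrAC.
Qed.

Lemma cis_lipschitz x y (e : R) : 0 < e -> exists2 r, 0 < r &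
  forall x' y', `|x' - x| < r -> `|y' - y| < r ->
    nrm (cis x' y' - cis x y) <= (e + expR x) * (`|x' - x| + `|y' - y|).
Proof.
move=> e0; have [r r0 h] := cis_expansion x y e0.
exists r => // x' y' h1 h2; have := h x' y' h1 h2.
set d := Complex _ _ => k.
rewrite (_ : _ - _ = cis x' y' - cis x y - cis x y * d + cis x y * d);
  last by ring.
apply: le_trans (nrmD _ _) _; rewrite mulrDl; apply: lerD => //.
by rewrite nrmM nrm_cis ler_wpM2l ?expR_ge0 // nrm_le_ReIm.
Qed.

(** The chain rule as an estimate uniform in both increments, as [closed_at] requires. Half of [e]
    is spent on the expansion of [F], through the Lipschitz constant [k] of [cis], and half on the
    expansion of [cis]. *)
Lemma polar_expansion (F : C -> C) z0 x y : derivable F (z0 + cis x y) 1 ->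
  exists l : C, forall e : R, 0 < e -> exists2 r, 0 < r &
    forall x' y', `|x' - x| < r -> `|y' - y| < r ->
    nrm (F (z0 + cis x' y') - F (z0 + cis x y) - l * Complex (x' - x) (y' - y))
      <= e * (`|x' - x| + `|y' - y|).
Proof.
move=> /derivable_nrm[l dl]; exists (l * cis x y) => e e0.
have l1 : 0 < nrm l + 1 by rewrite ltr_wpDl // nrm_ge0.
pose e2 := e / (2 * (nrm l + 1)).
have e20 : 0 < e2 by rewrite divr_gt0 // mulr_gt0.
pose k := e2 + expR x; have k0 : 0 < k by rewrite addr_gt0 // expR_gt0.
have e10 : 0 < e / (2 * k) by rewrite divr_gt0 // mulr_gt0.
have [r1 r10 h1] := dl _ e10.
have [r2 r20 h2] := cis_expansion x y e20.
have [r3 r30 h3] := cis_lipschitz x y e20.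
exists (Num.min (Num.min r2 r3) (r1 / (2 * k))).
  by rewrite !lt_min r20 r30 divr_gt0 // mulr_gt0.
move=> x' y'; rewrite !lt_min => /andP[/andP[x2 x3] x1] /andP[/andP[y2 y3] y1].
have {}h2 := h2 x' y' x2 y2; have {}h3 := h3 x' y' x3 y3.
set s := `|x' - x| + `|y' - y| in h2 h3 *.
have s0 : 0 <= s by rewrite addr_ge0.
have ksr : k * s < r1.
  have : s < r1 / (2 * k) + r1 / (2 * k) by apply: ltrD.
  rewrite (_ : _ + _ = r1 / k); last by field; rewrite gt_eqF.
  by rewrite ltr_pdivlMr // mulrC.
have zE : z0 + cis x' y' - (z0 + cis x y) = cis x' y' - cis x y by ring.
have := h1 (z0 + cis x' y'); rewrite zE => /(_ (le_lt_trans h3 ksr)) {}h1.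
set d := Complex _ _ in h2 *.
rewrite (_ : _ - _ - _ = (F (z0 + cis x' y') - F (z0 + cis x y) -
    l * (cis x' y' - cis x y)) + l * (cis x' y' - cis x y - cis x y * d));
      last by ring.
apply: le_trans (nrmD _ _) _; rewrite nrmM.
have g1 : nrm l * nrm (cis x' y' - cis x y - cis x y * d) <= e / 2 * s.
  have : nrm l * nrm (cis x' y' - cis x y - cis x y * d) <= (nrm l + 1) *
    (e2 * s).
    by apply: ler_pM; rewrite ?nrm_ge0 // lerDl.
  by rewrite (_ : (nrm l + 1) * (e2 * s) = e / 2 * s) // /e2; field;
    rewrite gt_eqF.
have g2 : e / (2 * k) * nrm (cis x' y' - cis x y) <= e / 2 * s.
  have : e / (2 * k) * nrm (cis x' y' - cis x y) <= e / (2 * k) * (k * s).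
    by rewrite ler_wpM2l // ltW.
  by rewrite (_ : e / (2 * k) * (k * s) = e / 2 * s) //; field; rewrite gt_eqF.
by have := le_trans h1 g2; lra.
Qed.

(** Writing [F = u + i v], the form [v dx + u dy] is the imaginary part of [F (dx + i dy)]. The
    witnesses [l2, l1, - l2] express the Cauchy-Riemann equations. *)
Lemma polar_closed (F : C -> C) z0 x y : derivable F (z0 + cis x y) 1 ->
  closed_at (fun x y => complex.Im (F (z0 + cis x y)))
            (fun x y => complex.Re (F (z0 + cis x y))) x y.
Proof.
move=> /polar_expansion[[l1 l2] dl]; exists l2, l1, (- l2) => e e0.
have [r r0 h] := dl e e0; exists r => // x' y' h1 h2.
have {}h := h x' y' h1 h2.
move: (le_trans (Re_le_nrm _) h) (le_trans (Im_le_nrm _) h).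
case: (F _) => a' b'; case: (F _) => a b /=.
have -> : a' - a - (l1 * (x' - x) - l2 * (y' - y)) =
  a' - a - (l1 * (x' - x) + - l2 * (y' - y)) by ring.
by rewrite (addrC (l1 * (y' - y))).
Qed.

Lemma polar_continuous (F : C -> C) z0 (phi : C -> R) :
  (forall z w, `|phi z - phi w| <= nrm (z - w)) ->
  (forall z, {for z, continuous F}) ->
  jointly_continuous (fun x y => phi (F (z0 + cis x y))).
Proof.
move=> phiP cF x y e e0.
have /continuous_nrm/(_ e e0)[r1 r10 h1] := cF (z0 + cis x y).
have [r2 r20 h2] := cis_lipschitz x y (ltr01 : 0 < 1 :> R).
have k0 : 0 < 1 + expR x by rewrite addr_gt0 // expR_gt0.
move: (1 + expR x) h2 k0 => k h2 k0.
exists (Num.min r2 (r1 / (2 * k))).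
  by rewrite lt_min r20 divr_gt0 // mulr_gt0.
move=> x' y'; rewrite !lt_min => /andP[x2 x1] /andP[y2 y1].
apply: le_trans (phiP _ _) _; apply/ltW/h1.
rewrite (_ : _ - _ = cis x' y' - cis x y); last by ring.
apply: le_lt_trans (h2 x' y' x2 y2) _; rewrite mulrC -ltr_pdivlMr //.
apply: lt_le_trans (ltrD x1 y1) _.
by rewrite (_ : _ + _ = r1 / k) //; field; rewrite gt_eqF.
Qed.

(** The means over circles about [z0] all agree; they tend to the real part of [F z0] for small
    radii and to 0 for large ones. *)
Lemma entire_vanish_Re (F : C -> C) (E : seq C) :
  (forall z, {for z, continuous F}) ->
  (forall z, z \notin E -> derivable F z 1) ->
  (forall e : R, 0 < e -> exists r : R, forall z, r < nrm z ->
    nrm (F z) <= e) ->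
  forall z0, complex.Re (F z0) = 0.
Proof.
move=> cF dF decay z0.
(* An exceptional point at the centre lies on no circle; the entry that [ln] yields for it merely
   excludes one more radius. *)
apply: (@circle_mean_eq R (fun x y => complex.Re (F (z0 + cis x y)))
  (fun x y => complex.Im (F (z0 + cis x y))) (pi *+ 2) _ _
    [seq ln (nrm (w - z0)) | w <- E]).
- by rewrite mulrn_wgt0 // pi_gt0.
- apply: polar_continuous cF => z w; rewrite -raddfB; exact: Re_le_nrm.
- apply: polar_continuous cF => z w; rewrite -raddfB; exact: Im_le_nrm.
- by move=> x; rewrite /cis cos0 sin0 cos2pi sin2pi.
- move=> x y xE; apply: polar_closed; apply: dF; apply: contra xE => wE.
  by apply/mapP; eexists; first exact: wE;
    rewrite addrAC subrr add0r nrm_cis expRK.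
- move=> e e0; have /continuous_nrm/(_ e e0)[r r0 h] := cF z0.
  exists (ln (r / 2)) => y; rewrite -raddfB; apply: le_trans (Re_le_nrm _) _.
  apply/ltW/h; rewrite addrAC subrr add0r nrm_cis lnK ?posrE; lra.
- move=> e e0; have [r h] := decay e e0.
  (* The circle of this radius about [z0] stays outside the disc of radius [r] about 0. *)
  exists (ln (`|r| + nrm z0 + 1)) => y; rewrite subr0.
  apply: le_trans (Re_le_nrm _) _; apply: h.
  have k0 : 0 < `|r| + nrm z0 + 1 by rewrite ltr_wpDl // addr_ge0 // nrm_ge0.
  have := nrmD (z0 + cis (ln (`|r| + nrm z0 + 1)) y) (- z0).
  rewrite addrAC subrr add0r nrm_cis lnK ?posrE // nrmN.
  by have := ler_norm r; lra.
Qed.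

Lemma entire_vanish (F : C -> C) (E : seq C) :
  (forall z, {for z, continuous F}) ->
  (forall z, z \notin E -> derivable F z 1) ->
  (forall e : R, 0 < e -> exists r : R, forall z, r < nrm z ->
    nrm (F z) <= e) ->
  forall z, F z = 0.
Proof.
move=> cF dF decay z; pose i : C := Complex 0 1.
have re := @entire_vanish_Re F E cF dF decay z.
have := @entire_vanish_Re (fun w => i * F w) E _ _ _ z.
have im : complex.Re (i * F z) = - complex.Im (F z).
  by case: (F z) => a b /=; rewrite mul0r mul1r sub0r.
rewrite im => H; apply/eqP; rewrite eq_complex re eqxx /= -oppr_eq0.
apply/eqP/H.
- by move=> w; apply: continuousM; [exact: cst_continuous|exact: cF].
- by move=> w /dF dw; exact: (@derivableM C C (cst i) F w 1
    (derivable_cst _ _ _) dw).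
- move=> e e0; have i1 : 0 < nrm i + 1 by rewrite ltr_wpDl // nrm_ge0.
  have [|r h] := decay (e / (nrm i + 1)); first by rewrite divr_gt0.
  exists r => w /h; rewrite nrmM ler_pdivlMr // mulrC => g.
  by apply: le_trans g; rewrite ler_wpM2r ?nrm_ge0 // lerDl.
Qed.
End PolarCoordinates.

(** * Polynomial growth by repeated division *)

Section PolynomialGrowth.
Variable R : realType.
Local Notation C := (cplx R).
Implicit Types F G : C -> C.

Lemma near_eq_continuous F G z0 : (\forall z \near z0, F z = G z) ->
  {for z0, continuous G} -> {for z0, continuous F}.
Proof.
move=> /near_nrm[r r0 FG] /continuous_nrm cG;
  apply/continuous_nrm => e /cG[s s0 h].
exists (Num.min r s) => [|z]; first by rewrite lt_min r0.
rewrite lt_min => /andP[zr zs]; rewrite !FG ?subrr ?nrm0 //; exact: h.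
Qed.

Lemma near_derivable F G z0 : (\forall z \near z0, F z = G z) ->
  derivable G z0 1 -> derivable F z0 1.
Proof.
move=> FG; have GF : {near z0, G =1 F} by apply: filterS FG => z ->.
exact: near_eq_derivable GF.
Qed.

Lemma derivable_mulf F G z : derivable F z 1 -> derivable G z 1 ->
  derivable (fun w => F w * G w) z 1.
Proof. move=> dF dG; exact: (derivableM dF dG). Qed.

Lemma derivable_subf F G z : derivable F z 1 -> derivable G z 1 ->
  derivable (fun w => F w - G w) z 1.
Proof. move=> dF dG; exact: (derivableB dF dG). Qed.

Lemma derivable_invf F z : F z != 0 -> derivable F z 1 ->
  derivable (fun w => (F w)^-1) z 1.
Proof. move=> nz dF; exact: (derivableV nz dF). Qed.

Lemma near_neq (a z0 : C) : z0 != a -> \forall z \near z0, z != a.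
Proof.
move=> za; apply/near_nrm; exists (nrm (z0 - a));
  first by rewrite nrm_gt0 subr_eq0.
move=> z h; apply/eqP => zE; move: h; rewrite zE -nrmN opprB ltxx //.
Qed.

Lemma exists_notin (E : seq C) : exists a, a \notin E.
Proof.
have s0 : 0 <= \sum_(e <- E) `|e| :> C by exact: sumr_ge0.
have le_s a : a \in E -> `|a| <= \sum_(e <- E) `|e|.
  by move=> aE; rewrite (big_rem _ aE) /= lerDl; exact: sumr_ge0.
exists (1 + \sum_(e <- E) `|e|); apply/negP => /le_s.
by rewrite ger0_norm ?addr_ge0 // gerDr ler10.
Qed.

(** [T] is the difference quotient at [a], completed by the derivative there. At [a] only continuity
    is claimed, so [a] joins the exceptional points. *)
Lemma divided_difference F (E : seq C) a :
  (forall z, {for z, continuous F}) ->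
  (forall z, z \notin E -> derivable F z 1) -> a \notin E ->
  exists T : C -> C, [/\ forall z, {for z, continuous T},
    forall z, z \notin a :: E -> derivable T z 1 &
    forall z, F z = F a + (z - a) * T z].
Proof.
move=> cF dF aE; have /derivable_nrm[l dl] := dF a aE.
pose G z := (F z - F a) * (z - a)^-1.
pose T z := if z == a then l else G z.
have TG z0 : z0 != a -> \forall z \near z0, T z = G z.
  by move=> /near_neq; apply: filterS => z zNa; rewrite /T (negPf zNa).
exists T; split.
- move=> z0; have [->|za] := eqVneq z0 a.
    apply/continuous_nrm => e e0; have [|r r0 h] := dl (e / 2).
      by rewrite divr_gt0.
    exists r => // z zr; rewrite /T eqxx; have [_|zNa] := eqVneq z a.
      by rewrite subrr nrm0.
    have za0 : z - a != 0 by rewrite subr_eq0.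
    have zap : 0 < nrm (z - a) by rewrite nrm_gt0.
    have -> : G z - l = (F z - F a - l * (z - a)) / (z - a) by rewrite /G;
      field.
    rewrite nrmM nrmV ltr_pdivrMr //; apply: le_lt_trans (h z zr) _.
    by rewrite ltr_pM2r //; lra.
  apply: near_eq_continuous (TG _ za) _; rewrite /G; apply: continuousM.
    by apply: continuousB; [exact: cF|exact: cst_continuous].
  apply: continuousV; first by rewrite subr_eq0.
  by apply: continuousB; [exact: cvg_id|exact: cst_continuous].
- move=> z; rewrite inE negb_or => /andP[za zE].
  apply: near_derivable (TG z za) _.
  apply: derivable_mulf; first exact: derivable_subf (dF z zE)
    (derivable_cst _ _ _).
  apply: derivable_invf; first by rewrite subr_eq0.
  exact: derivable_subf (@derivable_id _ _ _ _) (derivable_cst _ _ _).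
- move=> z; rewrite /T; have [->|za] := eqVneq z a;
    first by rewrite subrr mul0r addr0.
  by rewrite /G mulrC divfK ?subr_eq0 // addrC subrK.
Qed.

(** The extra factor [nrm z] makes [d] a bound on the size rather than on the degree. The case
    [d = 0] then says that [F] decays like [1 / |z|], so that [F] vanishes, and each division by
    [z - a] lowers [d] by one. *)
Lemma polynomial_of_growth d F (E : seq C) (A B : R) :
  (forall z, {for z, continuous F}) ->
  (forall z, z \notin E -> derivable F z 1) ->
  (forall z, B <= nrm z -> nrm (F z) * nrm z <= A * nrm z ^+ d) ->
  exists2 p : {poly C}, (size p <= d)%N & forall z, F z = p.[z].
Proof.
elim: d F E A B => [|d IH] F E A B cF dF growth.
  exists 0; first by rewrite size_poly0.
  move=> z; rewrite horner0; apply: (@entire_vanish R F E) => // e e0.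
  exists (Num.max B (`|A| / e)) => w; rewrite gt_max => /andP[Bw Aw].
  have w0 : 0 < nrm w by apply: le_lt_trans Aw; rewrite divr_ge0 // ltW.
  rewrite -(ler_pM2r w0); apply: le_trans (growth w (ltW Bw)) _.
  rewrite expr0 mulr1; apply: le_trans (ler_norm A) _.
  by rewrite mulrC -ler_pdivrMr // ltW.
have [a aE] := exists_notin E.
have [T [cT dT TE]] := divided_difference cF dF aE.
(* Beyond [2 * nrm a] one has [nrm z <= 2 * nrm (z - a)], and beyond 1 the constant [nrm (F a)] is
   at most [nrm (F a) * nrm z ^+ d]; this gives the constants. *)
have [|q sq qE] := IH T (a :: E) (2 * (`|A| + nrm (F a)))
    (Num.max (Num.max B 1) (2 * nrm a)) cT dT.
  move=> z; rewrite !ge_max => /andP[/andP[Bz z1] az].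
  have z0 : 0 < nrm z by lra.
  have h1 : nrm z <= 2 * nrm (z - a).
    by have := nrmD (z - a) a; rewrite subrK; lra.
  have h2 : nrm (F z) <= `|A| * nrm z ^+ d.
    rewrite -(ler_pM2r z0) -mulrA -exprSr; apply: le_trans (growth z Bz) _.
    by rewrite ler_wpM2r ?ler_norm // exprn_ge0 // ltW.
  have h3 : nrm (F a) <= nrm (F a) * nrm z ^+ d.
    by rewrite ler_peMr ?nrm_ge0 // exprn_ege1.
  have h4 : nrm (z - a) * nrm (T z) <= nrm (F z) + nrm (F a).
    rewrite -nrmM; have -> : (z - a) * T z = F z + - F a by rewrite (TE z);
      ring.
    by apply: le_trans (nrmD _ _) _; rewrite nrmN.
  have h5 : nrm (T z) * nrm z <= nrm (T z) * (2 * nrm (z - a)).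
    by rewrite ler_wpM2l ?nrm_ge0.
  apply: le_trans h5 _.
  rewrite (_ : _ * (2 * _) = 2 * (nrm (z - a) * nrm (T z))); last by ring.
  by rewrite -mulrA ler_pM2l // (le_trans h4) // mulrDl lerD.
exists ((F a)%:P + ('X - a%:P) * q).
  rewrite (leq_trans (size_polyD _ _)) // geq_max
    (leq_trans (size_polyC_leq1 _)) //=.
  by rewrite (leq_trans (size_polyMleq _ _)) // size_XsubC.
by move=> z; rewrite TE qE !hornerE.
Qed.
End PolynomialGrowth.

(** * Null polynomial curves of degree 7 *)

(** Certificates for linear algebra: the multipliers of the known relations are supplied by hand,
    and [field] or [ring] checks the remaining identity. *)
Lemma lincomb1 (F : fieldType) (c l x y : F) : l = 0 -> x - y = c * l -> x = y.
Proof. by move=> -> /eqP; rewrite mulr0 subr_eq0 => /eqP. Qed.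

Arguments lincomb1 [F] c [l x y].

Lemma lincomb2 (F : fieldType) (c l d m x y : F) :
  l = 0 -> m = 0 -> x - y = c * l + d * m -> x = y.
Proof. by move=> -> -> /eqP; rewrite !mulr0 addr0 subr_eq0 => /eqP. Qed.
Arguments lincomb2 [F] c [l] d [m x y].

Section PolynomialIdentities.
Variable K : numFieldType.
Implicit Types (f : {poly K}) (t w : K).

(** The point 0 is left out because the formulas for the reversed polynomial involve [w^-1]. *)
Lemma poly_eq0 f : (forall w, w != 0 -> f.[w] = 0) -> f = 0.
Proof.
move=> h; apply/eqP; apply: contraT => f0.
have := @max_poly_roots _ f [seq i.+1%:R | i <- iota 0 (size f)] f0.
rewrite size_map size_iota ltnn => -> //.
  by apply/allP => _ /mapP[i _ ->]; apply/eqP/h; rewrite pnatr_eq0.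
rewrite map_inj_uniq ?iota_uniq // => i j /eqP.
by rewrite eqr_nat => /eqP[].
Qed.

Lemma coef_translate f t k : (size f <= 8)%N -> (k < 8)%N ->
  (f \Po ('X + t%:P))`_k = (f^`N(k)).[t].
Proof.
move=> f8 k8; suff -> : f \Po ('X + t%:P) = \poly_(i < 8) (f^`N(i)).[t].
  by rewrite coef_poly k8.
apply/eqP; rewrite -subr_eq0; apply/eqP/poly_eq0 => w _.
rewrite !hornerE horner_comp !hornerE horner_poly [w + t]addrC.
by rewrite (nderiv_taylor_wide (mulrC _ _) f8) subrr.
Qed.

Lemma horner_reverse f w : (size f <= 8)%N -> w != 0 ->
  (\poly_(i < 8) f`_(7 - i)).[w] = w ^+ 7 * f.[w^-1].
Proof.
move=> f8 w0; rewrite horner_poly (horner_coef_wide _ f8).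
rewrite !big_ord_recl !big_ord0 /= /bump /= /subn /addn /=; field.
exact: w0.
Qed.

Lemma horner_deriv_reverse f w : (size f <= 8)%N -> w != 0 ->
  ((\poly_(i < 8) f`_(7 - i))^`()).[w] =
  7 * w ^+ 6 * f.[w^-1] - w ^+ 5 * (f^`()).[w^-1].
Proof.
move=> f8 w0; have sz (g : {poly K}) : (size g <= 8)%N -> (size (g^`()) <= 7)%N.
  move=> g8; have [->|/lt_size_deriv h] := eqVneq g 0;
    first by rewrite linear0 size_poly0.
  by rewrite -ltnS; apply: leq_trans h g8.
rewrite (horner_coef_wide _ (sz _ f8)) (horner_coef_wide _ f8).
rewrite (horner_coef_wide _ (sz _ (size_poly _ _))).
rewrite !big_ord_recl !big_ord0 /= /bump /= /addn /= !coef_deriv !coef_poly /=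
  /subn /=.
field; exact: w0.
Qed.

End PolynomialIdentities.

(** * Isotropic planes and null polynomial vectors in dimension 5 *)

Section NullPolynomials.
Variables (K : numClosedFieldType) (B : 'M[K]_5).
Hypotheses (B_sym : B^T = B) (B_unit : B \in unitmx).
Implicit Types (u v x y : 'rV[K]_5) (p q r : 'rV[{poly K}]_5) (z t : K).

Definition form u v : K := (u *m B *m v^T) 0 0.

Lemma formC u v : form u v = form v u.
Proof.
have E : v *m B *m u^T = (u *m B *m v^T)^T by rewrite !trmx_mul trmxK B_sym
  mulmxA.
by rewrite /form E [RHS]mxE.
Qed.

Lemma formDl u v w : form (u + v) w = form u w + form v w.
Proof. by rewrite /form !mulmxDl mxE. Qed.

Lemma formZl c u v : form (c *: u) v = c * form u v.
Proof. by rewrite /form -!scalemxAl mxE. Qed.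

Lemma formDr w u v : form w (u + v) = form w u + form w v.
Proof. by rewrite ![form w _]formC formDl. Qed.

Lemma formZr c u v : form u (c *: v) = c * form u v.
Proof. by rewrite ![form u _]formC formZl. Qed.

Lemma form0l v : form 0 v = 0.
Proof. by rewrite /form !mul0mx mxE. Qed.

Lemma formE u v : form u v = \sum_j \sum_k B j k * (u 0 j * v 0 k).
Proof.
rewrite /form mxE exchange_big; apply: eq_bigr => k _.
rewrite !mxE mulr_suml; apply: eq_bigr => j _; ring.
Qed.

(** As [B] is invertible, [A *m B] has the rank of [A]; its product with [A^T] being zero, twice
    that rank is at most 5. *)
Lemma isotropic_rank m (A : 'M[K]_(m, 5)) : A *m B *m A^T = 0 ->
  (\rank A <= 2)%N.
Proof.
move=> /mulmx0_rank_max; rewrite mxrank_tr mxrankMfree ?row_free_unit //.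
by case: (\rank A) => [|[|[|n]]] //; rewrite !addSn addnC.
Qed.

Definition free2 u v := forall a c : K, a *: u + c *: v = 0 -> a = 0 /\ c = 0.

Lemma isotropic_plane_orth u v x : free2 u v ->
  form u u = 0 -> form u v = 0 -> form v v = 0 ->
  form u x = 0 -> form v x = 0 -> form x x = 0 ->
  exists a c, x = a *: u + c *: v.
Proof.
move=> uv uu uv0 vv ux vx xx.
pose w (i : 'I_3) := [:: u; v; x]`_i.
have w_iso i j : form (w i) (w j) = 0.
  case: i j => [[|[|[|i]]] hi] [[|[|[|j]]] hj] //=; rewrite /w /= //;
    by rewrite formC.
pose A : 'M[K]_(3, 5) := \matrix_i w i.
have : (\rank A <= 2)%N.
  apply: isotropic_rank; apply/matrixP => i j; rewrite [RHS]mxE.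
  rewrite -(w_iso i j) /form -[w i](rowK w) -[w j](rowK w) -/A.
  by rewrite -row_mul !mxE; apply: eq_bigr => k _; rewrite !mxE.
rewrite leqNgt; move/negP => rk.
have : ~~ row_free A.
  by apply/negP => /eqP rA; apply: rk; rewrite rA.
rewrite -kermx_eq0 => /rowV0Pn[c /sub_kermxP cA c0].
have lin : c 0 0 *: u + c 0 1 *: v + c 0 2%:R *: x = 0.
  rewrite -cA mulmx_sum_row !big_ord_recl big_ord0 addr0 !rowK /w /= addrA.
  by congr (_ *: _ + _ *: _ + _ *: _); congr (c 0 _); apply: val_inj.
have [c2|c2] := eqVneq (c 0 2%:R) 0.
  move: lin; rewrite c2 scale0r addr0 => /uv[h0 h1]; case/negP: c0;
    apply/eqP/rowP => i.
  rewrite mxE; case: i => [[|[|[|i]]] hi] //.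
  - by rewrite -[RHS]h0; congr (c 0 _); apply: val_inj.
  - by rewrite -[RHS]h1; congr (c 0 _); apply: val_inj.
  - by rewrite -[RHS]c2; congr (c 0 _); apply: val_inj.
exists (- (c 0 0 / c 0 2%:R)), (- (c 0 1 / c 0 2%:R)).
have E : c 0 2%:R *: x = - (c 0 0 *: u + c 0 1 *: v).
  by move/eqP: lin; rewrite addrC addr_eq0 => /eqP.
apply: (scalerI c2); rewrite E scalerDr !scalerA !mulrN !(mulrC (c 0 2%:R)).
by rewrite !divfK // !scaleNr opprD.
Qed.

Definition coef_row p i : 'rV[K]_5 := map_mx (fun f : {poly K} => f`_i) p.
Definition eval_row p z : 'rV[K]_5 := map_mx (fun f : {poly K} => f.[z]) p.
Definition deriv_row p : 'rV[{poly K}]_5 :=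
  map_mx (fun f : {poly K} => f^`()) p.
Definition pform p q : {poly K} :=
  \sum_j \sum_k (B j k)%:P * (p 0 j * q 0 k).

Lemma pform_eval p q z : (pform p q).[z] = form (eval_row p z) (eval_row q z).
Proof.
rewrite formE /pform horner_sum; apply: eq_bigr => j _.
by rewrite horner_sum; apply: eq_bigr => k _; rewrite !hornerE !mxE.
Qed.

Lemma pform_coef p q n :
  (pform p q)`_n = \sum_(i < n.+1) form (coef_row p i) (coef_row q (n - i)).
Proof.
rewrite /pform coef_sum; under [RHS]eq_bigr do rewrite formE.
rewrite exchange_big; apply: eq_bigr => j _ /=.
rewrite coef_sum exchange_big; apply: eq_bigr => k _ /=.
by rewrite coefCM coefM mulr_sumr; apply: eq_bigr => i _; rewrite !mxE.
Qed.

Lemma pformC p q : pform p q = pform q p.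
Proof.
rewrite /pform exchange_big; apply: eq_bigr => j _; apply: eq_bigr => k _ /=.
have -> : B k j = B j k by rewrite -[in RHS]B_sym mxE.
by congr (_ * _); rewrite mulrC.
Qed.

Lemma pform_deriv p q : (pform p q)^`() =
  pform (deriv_row p) q + pform p (deriv_row q).
Proof.
rewrite /pform raddf_sum -big_split; apply: eq_bigr => j _ /=.
rewrite raddf_sum -big_split; apply: eq_bigr => k _ /=.
by rewrite derivM derivC mul0r add0r derivM mulrDr !mxE.
Qed.

Lemma coef_deriv_row p i : coef_row (deriv_row p) i =
  i.+1%:R *: coef_row p i.+1.
Proof. by apply/rowP => j; rewrite !mxE coef_deriv mulr_natl. Qed.

Lemma eval_row0 p : eval_row p 0 = coef_row p 0.
Proof. by apply/rowP => j; rewrite !mxE horner_coef0. Qed.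

(** * Linear relations between the products of coefficients *)

Definition gram p i j := form (coef_row p i) (coef_row p j).

Lemma gramC p i j : gram p i j = gram p j i.
Proof. exact: formC. Qed.

(** [null_free] says that the curve is immersed at the finite points; infinity is treated in
    [immersed_null]. *)
Record null_poly p : Prop := NullPoly {
  null_size : forall j, (size (p ord0 j) <= 8)%N;
  null0 : pform p p = 0;
  null1 : pform (deriv_row p) (deriv_row p) = 0;
  null_free : forall z, free2 (eval_row p z) (eval_row (deriv_row p) z) }.

Lemma coef_row_big p i : null_poly p -> (8 <= i)%N -> coef_row p i = 0.
Proof.
move=> np i8; apply/rowP => j; rewrite !mxE nth_default //.
exact: leq_trans (null_size np j) i8.
Qed.

Lemma gram_big p i j : null_poly p -> (8 <= i)%N || (8 <= j)%N -> gram p i j =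
  0.
Proof.
move=> np /orP[] /(coef_row_big np) E; first by rewrite /gram E form0l.
by rewrite gramC /gram E form0l.
Qed.

Lemma gram_sum p n : null_poly p -> \sum_(0 <= i < n.+1) gram p i (n - i) = 0.
Proof.
by move=> np; rewrite big_mkord -pform_coef null0 // coef0.
Qed.

(** This is the coefficient of [z^n] in [<P', P'> = 0]. It relates the products with
    [i + j = n + 2], so from total degree 2 on it gives a second relation beside [gram_sum]. *)
Lemma gram_wsum p n : null_poly p ->
  \sum_(0 <= i < n.+1) (i.+1)%:R * (n - i).+1%:R * gram p i.+1 (n - i).+1 = 0.
Proof.
move=> np; rewrite big_mkord.
transitivity (pform (deriv_row p) (deriv_row p))`_n;
  last by rewrite null1 // coef0.
rewrite pform_coef; apply: eq_bigr => i _.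
by rewrite !coef_deriv_row formZl formZr mulrA.
Qed.

(** Up to total degree 3 there are at most two unordered pairs [i, j] in each degree, and the
    relations leave only the zero solution. *)
Lemma gram_low p : null_poly p ->
  [/\ gram p 0 0 = 0, gram p 0 1 = 0, gram p 1 1 = 0 &
   [/\ gram p 0 2 = 0, gram p 0 3 = 0 & gram p 1 2 = 0]].
Proof.
move=> np.
have := gram_sum 3 np; have := gram_sum 2 np; have := gram_sum 1 np.
have := gram_sum 0 np; have := gram_wsum 0 np; have := gram_wsum 1 np.
rewrite unlock /subn /= !(gramC p 1 0) !(gramC p 2 _) !(gramC p 3 _).
move=> w3 w2 s0 s1 s2 s3.
have k00 : gram p 0 0 = 0 by rewrite -[RHS]s0; ring.
have k01 : gram p 0 1 = 0 by apply: (lincomb1 2^-1 s1); field.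
have k11 : gram p 1 1 = 0 by apply: (lincomb1 1 w2); field.
have k02 : gram p 0 2 = 0 by apply: (lincomb2 2^-1 (- 2^-1) s2 w2); field.
have k12 : gram p 1 2 = 0 by apply: (lincomb1 4^-1 w3); field.
have k03 : gram p 0 3 = 0 by apply: (lincomb2 2^-1 (- 4^-1) s3 w3); field.
by split.
Qed.

(** Degrees 4 and 5 have three unordered pairs, hence one free product each. Degrees 6, 7 and 8 have
    four, hence two free products; in degree 8 the pair 0, 8 is absent because the curve has degree
    7. *)
Lemma gram_deg4 p : null_poly p ->
  gram p 0 4 = gram p 2 2 / 6 /\ gram p 1 3 = - (2 / 3 * gram p 2 2).
Proof.
move=> np; have := gram_sum 4 np; have := gram_wsum 2 np.
rewrite unlock /subn /= !(gramC p 4 _) !(gramC p 3 _) => w s; split.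
  by apply: (lincomb2 2^-1 (- 6^-1) s w); field.
by apply: (lincomb1 6^-1 w); field.
Qed.

Lemma gram_deg5 p : null_poly p ->
  gram p 0 5 = gram p 2 3 / 2 /\ gram p 1 4 = - (3 / 2 * gram p 2 3).
Proof.
move=> np; have := gram_sum 5 np; have := gram_wsum 3 np.
rewrite unlock /subn /= !(gramC p 5 _) !(gramC p 4 _) !(gramC p 3 _) => w s;
  split.
  by apply: (lincomb2 2^-1 (- 8^-1) s w); field.
by apply: (lincomb1 8^-1 w); field.
Qed.

Lemma gram_deg6 p : null_poly p ->
  gram p 1 5 = - (8 / 5 * gram p 2 4) - 9 / 10 * gram p 3 3 /\
  gram p 0 6 = 3 / 5 * gram p 2 4 + 2 / 5 * gram p 3 3.
Proof.
move=> np; have := gram_sum 6 np; have := gram_wsum 4 np.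
rewrite unlock /subn /= !(gramC p 6 _) !(gramC p 5 _) !(gramC p 4 _) => w s;
  split.
  by apply: (lincomb1 10^-1 w); field.
by apply: (lincomb2 2^-1 (- 10^-1) s w); field.
Qed.

Lemma gram_deg7 p : null_poly p ->
  gram p 1 6 = - (5 / 3 * gram p 2 5) - 2 * gram p 3 4 /\
  gram p 0 7 = 2 / 3 * gram p 2 5 + gram p 3 4.
Proof.
move=> np; have := gram_sum 7 np; have := gram_wsum 5 np.
rewrite unlock /subn /= !(gramC p 7 _) !(gramC p 6 _) !(gramC p 5 _)
  !(gramC p 4 _).
move=> w s; split; first by apply: (lincomb1 12^-1 w); field.
by apply: (lincomb2 2^-1 (- 12^-1) s w); field.
Qed.

Lemma gram_deg8 p : null_poly p ->
  gram p 2 6 = - (9 / 4 * gram p 1 7) - gram p 3 5 / 4 /\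
  gram p 4 4 = 5 / 2 * gram p 1 7 - 3 / 2 * gram p 3 5.
Proof.
move=> np; have := gram_sum 8 np; have := gram_wsum 6 np.
rewrite unlock /subn /= (@gram_big p 0 8 np isT) (@gram_big p 8 0 np isT).
rewrite !(gramC p 7 _) !(gramC p 6 _) !(gramC p 5 _) => w s; split.
  by apply: (lincomb2 2 (- 8^-1) s w); field.
by apply: (lincomb2 (- 3) 4^-1 s w); field.
Qed.

Lemma gram_lin p i a c j : coef_row p i =
  a *: coef_row p 0 + c *: coef_row p 1 ->
  gram p i j = a * gram p 0 j + c * gram p 1 j.
Proof. by move=> E; rewrite /gram E formDl !formZl. Qed.

Lemma null_free0 p : null_poly p -> free2 (coef_row p 0) (coef_row p 1).
Proof.
move=> np; have := null_free np (z := 0);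
  rewrite !eval_row0 coef_deriv_row => h a c E.
by apply: h; rewrite scale1r.
Qed.

Lemma null_span p v : null_poly p ->
  form (coef_row p 0) v = 0 -> form (coef_row p 1) v = 0 -> form v v = 0 ->
  exists a c, v = a *: coef_row p 0 + c *: coef_row p 1.
Proof.
move=> np; have [k00 k01 k11 _] := gram_low np.
exact: (isotropic_plane_orth (null_free0 np)).
Qed.

(* [T^perp / T] is anisotropic, where [T] is the tangent plane, so [P''] lies in
   [T] wherever [<P'', P''>] vanishes. *)
Lemma gram_at_zero p : null_poly p -> gram p 2 2 = 0 ->
  [/\ exists a c, coef_row p 2 = a *: coef_row p 0 + c *: coef_row p 1,
      gram p 0 4 = 0 /\ gram p 1 3 = 0,
      [/\ gram p 0 5 = 0, gram p 1 4 = 0 & gram p 2 3 = 0] &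
      [/\ gram p 2 4 = 0, gram p 1 5 = - (9 / 10 * gram p 3 3) &
          gram p 0 6 = 2 / 5 * gram p 3 3]].
Proof.
move=> np k22; have [k00 k01 k11 [k02 k03 k12]] := gram_low np.
have [a [c E]] := null_span np k02 k12 k22.
have [k04 k13] := gram_deg4 np; rewrite k22 mul0r in k04;
  rewrite k22 mulr0 oppr0 in k13.
have k23 : gram p 2 3 = 0 by rewrite (gram_lin _ E) k03 k13 !mulr0 addr0.
have [k05 k14] := gram_deg5 np; rewrite k23 mul0r in k05;
  rewrite k23 mulr0 oppr0 in k14.
have k24 : gram p 2 4 = 0 by rewrite (gram_lin _ E) k04 k14 !mulr0 addr0.
have [k15 k06] := gram_deg6 np; rewrite k24 !mulr0 ?oppr0 !add0r in k15 k06.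
by split; [exists a, c|split|split|split].
Qed.

(** The same curve in the coordinate [w = 1/z], namely [w^7 P(1/w)]. *)
Definition reverse p : 'rV[{poly K}]_5 :=
  map_mx (fun f : {poly K} => \poly_(i < 8) f`_(7 - i)) p.

Lemma coef_reverse p i : (i < 8)%N -> coef_row (reverse p) i =
  coef_row p (7 - i).
Proof. by move=> i8; apply/rowP => j; rewrite !mxE coef_poly i8. Qed.

Lemma gram_reverse p i j : (i < 8)%N -> (j < 8)%N ->
  gram (reverse p) i j = gram p (7 - i) (7 - j).
Proof. by move=> i8 j8; rewrite /gram !coef_reverse. Qed.

(** Here both [P_2] and [P_3] lie in the span of [P_0] and [P_1], so their products with [P_j]
    follow from those of [P_0] and [P_1], of lower total degree. Alternating this with the relations
    of each degree kills every product with an index below 4. *)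
Lemma gram_vanish p : null_poly p -> null_poly (reverse p) ->
  gram p 2 2 = 0 -> gram p 3 3 = 0 -> forall i j, gram p i j = 0.
Proof.
move=> np nr k22 k33; have [k00 k01 k11 [k02 k03 k12]] := gram_low np.
have [[a [c E]] [k04 k13] [k05 k14 k23] [k24 k15 k06]] := gram_at_zero np k22.
rewrite k33 !mulr0 ?oppr0 in k15 k06.
have [a' [c' E']] := null_span np k03 k13 k33.
have k25 : gram p 2 5 = 0 by rewrite (gram_lin _ E) k05 k15 !mulr0 addr0.
have k34 : gram p 3 4 = 0 by rewrite (gram_lin _ E') k04 k14 !mulr0 addr0.
have [k16 k07] := gram_deg7 np; rewrite k25 k34 !mulr0 oppr0 addr0 in k16 k07.
have k26 : gram p 2 6 = 0 by rewrite (gram_lin _ E) k06 k16 !mulr0 addr0.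
have k35 : gram p 3 5 = 0 by rewrite (gram_lin _ E') k05 k15 !mulr0 addr0.
have [k17 k44] := gram_deg8 np; rewrite k26 k35 mul0r subr0 in k17.
move/eqP: k17; rewrite eq_sym oppr_eq0 mulf_eq0 mulf_eq0 invr_eq0 !pnatr_eq0 /=.
move=> /eqP k17; rewrite k17 k35 !mulr0 subr0 in k44.
have k27 : gram p 2 7 = 0 by rewrite (gram_lin _ E) k07 k17 !mulr0 addr0.
have k36 : gram p 3 6 = 0 by rewrite (gram_lin _ E') k06 k16 !mulr0 addr0.
have k37 : gram p 3 7 = 0 by rewrite (gram_lin _ E') k07 k17 !mulr0 addr0.
(* The remaining products have both indices at least 4, where the relations of the reversed curve
   apply. *)
have [r00 r01 r11 [r02 r03 r12]] := gram_low nr.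
have [r04 r13] := gram_deg4 nr; have [r05 r14] := gram_deg5 nr.
rewrite !gram_reverse // /subn /= in r00 r01 r11 r02 r03 r12 r04 r13 r05 r14.
have nz n : (n.+1%:R : K) != 0 by rewrite pnatr_eq0.
have k45 : gram p 4 5 = 0.
  by move/eqP: r05; rewrite gramC k27 (gramC p 5 4) eq_sym mulf_eq0 invr_eq0
    (negPf (nz _)) orbF => /eqP.
have k55 : gram p 5 5 = 0.
  by move/eqP: r04; rewrite gramC k37 eq_sym mulf_eq0 invr_eq0 (negPf (nz _))
    orbF => /eqP.
have k46 : gram p 4 6 = 0 by rewrite gramC r13 k55 mulr0 oppr0.
have all i j : (i <= j)%N -> gram p i j = 0.
  have [i8|] := ltnP i 8; last by move=> i8 _; rewrite gram_big // i8.
  have [j8|] := ltnP j 8; last by move=> j8 _; rewrite gram_big // j8 orbT.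
  case: i i8 => [|[|[|[|[|[|[|[|i]]]]]]]] //= _;
    case: j j8 => [|[|[|[|[|[|[|[|j]]]]]]]] //= _ _; rewrite // gramC //.
by move=> i j; case/orP: (leq_total i j) => /all // <-; rewrite gramC.
Qed.

(** * The form [q] and its roots at 0 and infinity *)

Definition osc p := pform (deriv_row (deriv_row p)) (deriv_row (deriv_row p)).

Lemma osc_coef p n : (osc p)`_n =
  \sum_(0 <= i < n.+1) ((i.+1 * i.+2)%:R * ((n - i).+1 * (n - i).+2)%:R) *
    gram p i.+2 (n - i).+2.
Proof.
rewrite big_mkord pform_coef; apply: eq_bigr => i _.
by rewrite !coef_deriv_row !scalerA formZl formZr mulrA !natrM.
Qed.

Lemma osc_coef0 p : (osc p)`_0 = 4 * gram p 2 2.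
Proof. rewrite osc_coef unlock /subn /= /muln /=; ring. Qed.

(** Since [gram p 5 5] is [gram (reverse p) 2 2], this is [osc_coef0] at infinity, with [q] read as
    a form of degree 6. *)
Lemma osc_coef6 p : null_poly p -> null_poly (reverse p) ->
  (osc p)`_6 = 4 * gram p 5 5.
Proof.
move=> np nr.
have [r04 r13] := gram_deg4 nr; rewrite !gram_reverse // /subn /= in r04 r13.
rewrite gramC in r04; rewrite gramC in r13.
rewrite osc_coef unlock /subn /= /muln /= (@gram_big p 2 8 np isT)
  (@gram_big p 8 2 np isT).
rewrite !(gramC p 7 _) !(gramC p 6 _) r04 r13; by field.
Qed.

(** The constant coefficient of [q] is [4 * gram p 2 2]; once it vanishes, the coefficient of [z^2]
    reduces to [36 * gram p 3 3]. *)
Lemma gram_eq0_of_osc p : null_poly p -> null_poly (reverse p) -> osc p = 0 ->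
  forall i j, gram p i j = 0.
Proof.
move=> np nr h0.
have k22 : gram p 2 2 = 0.
  by have := osc_coef0 p; rewrite h0 coef0 => /esym h; apply: (lincomb1 4^-1 h);
    field.
apply: gram_vanish => //.
have [_ _ _ [k24 _ _]] := gram_at_zero np k22.
have := osc_coef p 2; rewrite h0 coef0 unlock /subn /= /muln /= !(gramC p 4 _)
  k24 => h.
by apply: (lincomb1 36^-1 (esym h)); field.
Qed.

(** [P_7] and [P_6] are the value and the derivative at 0 of the reversed vector, so the second
    condition is immersion at infinity. *)
Definition immersed_null p := null_poly p /\
  free2 (coef_row p 7) (coef_row p 6).

Definition translate p t : 'rV[{poly K}]_5 :=
  map_mx (fun f : {poly K} => f \Po ('X + t%:P)) p.

Lemma pform_translate p q t : pform (translate p t) (translate q t) =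
  pform p q \Po ('X + t%:P).
Proof.
rewrite /pform rmorph_sum; apply: eq_bigr => j _.
rewrite rmorph_sum; apply: eq_bigr => k _.
by rewrite !rmorphM /= comp_polyC !mxE.
Qed.

Lemma deriv_translate p t : deriv_row (translate p t) =
  translate (deriv_row p) t.
Proof.
by apply/matrixP => i j; rewrite !mxE deriv_comp derivD derivX derivC addr0
  mulr1.
Qed.

Lemma eval_translate p t z : eval_row (translate p t) z = eval_row p (z + t).
Proof. by apply/matrixP => i j; rewrite !mxE horner_comp !hornerE. Qed.

Lemma osc_translate p t : osc (translate p t) = osc p \Po ('X + t%:P).
Proof. by rewrite /osc !deriv_translate pform_translate. Qed.

(** A translation fixes infinity: [P_7] is unchanged and [P_6] changes by a multiple of [P_7]. *)
Lemma immersed_null_translate p t : immersed_null p ->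
  immersed_null (translate p t).
Proof.
move=> [np fr]; split; first split.
- by move=> j; rewrite mxE size_comp_poly2 ?size_XaddC //; exact: null_size.
- by rewrite pform_translate null0 // comp_poly0.
- by rewrite deriv_translate pform_translate null1 // comp_poly0.
- by move=> z; rewrite deriv_translate !eval_translate; exact: null_free.
have sz j : (size (p ord0 j) <= 8)%N := null_size np j.
have c7 : coef_row (translate p t) 7 = coef_row p 7.
  apply/rowP => j; rewrite !mxE coef_translate // (@horner_coef_wide _ 1).
    by rewrite big_ord_recl big_ord0 coef_nderivn /= binn mulr1 addr0.
  by apply/leq_sizeP => i i1; rewrite coef_nderivn nth_default ?mul0rn //
    (leq_trans (sz j)) // -[8]/(7 + 1)%N leq_add2l.
have c6 : coef_row (translate p t) 6 = coef_row p 6 + (7 * t) *: coef_row p 7.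
  apply/rowP => j; rewrite !mxE coef_translate // (@horner_coef_wide _ 2).
    rewrite !big_ord_recl big_ord0 !coef_nderivn /= /bump /= binn.
    rewrite -[(6 + (1 + 0))%N]/7%N -[(6 + 0)%N]/6%N (_ : 'C(7, 6) = 7%N) //;
      ring.
  by apply/leq_sizeP => i i1; rewrite coef_nderivn nth_default ?mul0rn //
    (leq_trans (sz j)) // -[8]/(6 + 2)%N leq_add2l.
rewrite c7 c6 => a c h; have [|h1 h2] := fr (a + c * (7 * t)) c.
  by rewrite -[RHS]h scalerDr scalerA scalerDl -addrA [c *: _ + _ in RHS]addrC.
by move: h1; rewrite h2 mul0r addr0.
Qed.

Lemma eval_reverse p z : null_poly p -> z != 0 -> eval_row (reverse p) z =
  z ^+ 7 *: eval_row p z^-1.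
Proof.
by move=> np z0; apply/rowP => j; rewrite !mxE horner_reverse //;
  exact: null_size.
Qed.

Lemma eval_deriv_reverse p z : null_poly p -> z != 0 ->
  eval_row (deriv_row (reverse p)) z =
  (7 * z ^+ 6) *: eval_row p z^-1 - z ^+ 5 *: eval_row (deriv_row p) z^-1.
Proof.
by move=> np z0; apply/rowP => j; rewrite !mxE horner_deriv_reverse //;
  exact: null_size.
Qed.

Lemma pform_der p : null_poly p -> pform p (deriv_row p) = 0.
Proof.
move=> np; have := pform_deriv p p; rewrite null0 // linear0
  (pformC (deriv_row p)).
by rewrite -mulr2n -mulr_natl => /esym/eqP;
  rewrite mulf_eq0 -polyC_natr polyC_eq0 pnatr_eq0 /= => /eqP.
Qed.

Lemma immersed_null_reverse p : immersed_null p -> immersed_null (reverse p).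
Proof.
move=> [np fr]; split; last first.
  by rewrite !coef_reverse // /subn /=; exact: null_free0.
have f00 z : form (eval_row p z) (eval_row p z) =
  0 by rewrite -pform_eval null0 // horner0.
have f01 z : form (eval_row p z) (eval_row (deriv_row p) z) =
  0 by rewrite -pform_eval pform_der // horner0.
have f11 z : form (eval_row (deriv_row p) z) (eval_row (deriv_row p) z) =
  0 by rewrite -pform_eval null1 // horner0.
split.
- by move=> j; rewrite mxE size_poly.
- apply: poly_eq0 => z z0; rewrite pform_eval eval_reverse //.
  by rewrite formZl formZr f00 !mulr0.
- apply: poly_eq0 => z z0; rewrite pform_eval eval_deriv_reverse // -scaleNr.
  rewrite formDl !formDr !formZl !formZr f00 f01 formC f01 f11; ring.
- move=> z; have [->|z0] := eqVneq z 0.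
    by rewrite !eval_row0 coef_deriv_row scale1r !coef_reverse.
  rewrite eval_reverse // eval_deriv_reverse // => a c h.
  have zn n : z ^+ n != 0 by rewrite expf_neq0.
  (* The value and derivative of the reversed vector are a triangular combination of those of [p] at
     [z^-1], with diagonal entries [z ^+ 7] and [- z ^+ 5]. *)
  have [|h1 h2] := null_free np (a := a * z ^+ 7 + c * (7 * z ^+ 6))
    (c := - (c * z ^+ 5)) (z := z^-1).
    by rewrite -h scalerBr !scalerA scalerDl scaleNr addrA.
  move/eqP: h2; rewrite oppr_eq0 mulf_eq0 (negPf (zn _)) orbF => /eqP c0.
  by move/eqP: h1; rewrite c0 mul0r addr0 mulf_eq0 (negPf (zn _)) orbF => /eqP.
Qed.

Lemma gram_low5 p i j : null_poly p -> gram p 2 2 = 0 -> (i + j <= 5)%N ->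
  gram p i j = 0.
Proof.
move=> np k22; have [k00 k01 k11 [k02 k03 k12]] := gram_low np.
have [_ [k04 k13] [k05 k14 k23] _] := gram_at_zero np k22.
by case: i j => [|[|[|[|[|[|i]]]]]] [|[|[|[|[|[|j]]]]]] //= _; rewrite // gramC.
Qed.

Lemma gram_reverseK p i j : (i < 8)%N -> (j < 8)%N ->
  gram p i j = gram (reverse p) (7 - i) (7 - j).
Proof. by move=> i8 j8; rewrite gram_reverse ?ltnS ?leq_subr // !subKn. Qed.

(** The substitution [i -> 7 - i] turns [i + j >= 9] into [i + j <= 5]. With roots of [q] at 0 and
    at infinity, only the total degrees 6, 7 and 8 survive. *)
Lemma gram_high p i j : null_poly p -> null_poly (reverse p) -> gram p 5 5 =
  0 ->
  (9 <= i + j)%N -> gram p i j = 0.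
Proof.
move=> np nr k55 ij.
have [i8|i8] := ltnP i 8; last by rewrite gram_big // i8.
have [j8|j8] := ltnP j 8; last by rewrite gram_big // j8 orbT.
rewrite gram_reverseK //; apply: gram_low5 => //; first by rewrite gram_reverse.
by move: ij i8 j8; lia.
Qed.

Lemma osc_eq0_of_gram p : (forall i j, gram p i j = 0) -> osc p = 0.
Proof.
move=> h; apply/polyP => n; rewrite osc_coef coef0.
by rewrite big1 // => i _; rewrite h mulr0.
Qed.

Lemma gram33_neq0 p : immersed_null p -> osc p != 0 -> gram p 2 2 = 0 ->
  gram p 3 3 != 0.
Proof.
move=> gp h0 k22; apply: contra h0 => /eqP k33.
by apply/eqP/osc_eq0_of_gram/gram_vanish => //;
  [case: gp|case: (immersed_null_reverse gp)].
Qed.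

Lemma osc_reverse_neq0 p : immersed_null p -> osc p != 0 ->
  osc (reverse p) != 0.
Proof.
move=> gp; apply: contra => /eqP h0; apply/eqP/osc_eq0_of_gram => i j.
have [i8|i8] := ltnP i 8; last by rewrite gram_big //; [case: gp|rewrite i8].
have [j8|j8] := ltnP j 8; last by rewrite gram_big //;
  [case: gp|rewrite j8 orbT].
rewrite gram_reverseK //; apply: gram_eq0_of_osc h0 _ _;
  first by case: (immersed_null_reverse gp).
by case: (immersed_null_reverse (immersed_null_reverse gp)).
Qed.

Lemma osc_translate_neq0 p t : osc p != 0 -> osc (translate p t) != 0.
Proof. by rewrite osc_translate comp_poly2_eq0 // size_XaddC. Qed.

Lemma gram22_translate p t : root (osc p) t -> gram (translate p t) 2 2 = 0.
Proof.
move=> /rootP rt; have := osc_coef0 (translate p t).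
rewrite osc_translate -horner_coef0 horner_comp !hornerE rt => /esym h.
by apply: (lincomb1 4^-1 h); field.
Qed.

Lemma gram55_osc p : immersed_null p -> (osc p)`_6 = 0 -> gram p 5 5 = 0.
Proof.
move=> gp h; have := osc_coef6 gp.1 (immersed_null_reverse gp).1;
  rewrite h => /esym E.
by apply: (lincomb1 4^-1 E); field.
Qed.

(** A nonconstant [q] has a finite root, which is translated to 0 and sent to infinity by reversal.
    A nonzero constant [q] already vanishes at infinity as a form of degree 6. *)
Lemma exists_root_infty p : immersed_null p -> osc p != 0 ->
  exists q, [/\ immersed_null q, osc q != 0 & gram q 5 5 = 0].
Proof.
move=> gp h0; have [sz|/closed_rootP[t rt]] := eqVneq (size (osc p)) 1%N.
  exists p; split=> //; apply: gram55_osc => //.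
  by rewrite nth_default // sz.
exists (reverse (translate p t)); split; first
  exact/immersed_null_reverse/immersed_null_translate.
  by apply: osc_reverse_neq0; [exact: immersed_null_translate|exact:
    osc_translate_neq0].
by rewrite gram_reverse //; exact: gram22_translate.
Qed.

Lemma osc_size p : null_poly p -> null_poly (reverse p) -> gram p 5 5 = 0 ->
  (size (osc p) <= 5)%N.
Proof.
move=> np nr k55; apply/leq_sizeP => n n5;
  rewrite osc_coef big_nat big1 // => i /andP[_ ni].
rewrite (gram_high np nr k55) ?mulr0 //.
rewrite !addSn !addnS subnKC //.
Qed.

Lemma gram_infty p : null_poly p -> null_poly (reverse p) -> gram p 5 5 = 0 ->
  [/\ gram p 3 5 = 0, gram p 2 6 = - (9 / 10 * gram p 4 4) &
      gram p 1 7 = 2 / 5 * gram p 4 4].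
Proof.
move=> np nr k55; have k22 : gram (reverse p) 2 2 = 0 by rewrite gram_reverse.
have [_ _ _ []] := gram_at_zero nr k22; rewrite !gram_reverse // /subn /=.
by rewrite (gramC p 5) (gramC p 6) (gramC p 7) => -> -> ->.
Qed.

(** The root at infinity has order exactly two, so [q] is a polynomial of degree 4 with leading
    coefficient [36 * gram p 4 4] and has a finite root. Translating that root to 0 keeps infinity
    fixed. *)
Lemma exists_roots_zero_infty p : immersed_null p -> osc p != 0 ->
  exists q, [/\ immersed_null q, osc q != 0, gram q 2 2 = 0 & gram q 5 5 = 0].
Proof.
move=> gp /(exists_root_infty gp)[{gp}p [gp h0 k55]].
have [np _] := gp; have [nr _] := immersed_null_reverse gp.
have k44 : gram p 4 4 != 0.
  have := gram33_neq0 (immersed_null_reverse gp) (osc_reverse_neq0 gp h0).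
  by rewrite !gram_reverse // => /(_ k55).
have c4 : (osc p)`_4 != 0.
  have [k35 k26 _] := gram_infty np nr k55.
  suff -> : (osc p)`_4 = 36 * gram p 4 4 by rewrite mulf_neq0 ?pnatr_eq0.
  rewrite osc_coef unlock /subn /= /muln /= !(gramC p 6 _) !(gramC p 5 _).
  by rewrite k35 k26; field.
have [t rt] : exists t, root (osc p) t.
  apply/closed_rootP; rewrite neq_ltn; apply/orP; right.
  by rewrite ltnNge; apply: contra c4 => sz;
    rewrite nth_default // (leq_trans sz).
exists (translate p t); split; [exact: immersed_null_translate|exact:
  osc_translate_neq0|exact: gram22_translate|].
apply: gram55_osc; first exact: immersed_null_translate.
rewrite nth_default // osc_translate size_comp_poly2 ?size_XaddC //.
by rewrite (leq_trans (osc_size np nr k55)).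
Qed.

(** [<P'', P''''>] provides the extra equation at the third root. *)
Definition osc4 p := pform (deriv_row (deriv_row p))
  (deriv_row (deriv_row (deriv_row (deriv_row p)))).

Lemma osc4_coef p n : (osc4 p)`_n = \sum_(0 <= i < n.+1)
  ((i.+1 * i.+2)%:R * ((n - i).+1 * (n - i).+2 * (n - i).+3 * (n - i).+4)%:R)
  * gram p i.+2 (n - i).+4.
Proof.
rewrite big_mkord pform_coef; apply: eq_bigr => i _.
by rewrite !coef_deriv_row !scalerA formZl formZr mulrA !natrM.
Qed.

(** Differentiating the null relations gives [<P, P'''> = 0], [<P', P'''> = - q], [<P, P''''> = q]
    and [<P', P''''> = - 3 <P'', P'''>]. At a root [P''] is a combination of [P] and [P']; pairing
    it first with [P'''], then with [P''''], gives both claims. *)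
Lemma osc_root p t : null_poly p -> root (osc p) t ->
  (osc p)^`().[t] = 0 /\ (osc4 p).[t] = 0.
Proof.
move=> np /rootP rt; rewrite /osc /osc4.
have f01 := pform_der np.
have f02 : pform p (deriv_row (deriv_row p)) = 0.
  by have := pform_deriv p (deriv_row p); rewrite f01 null1 // linear0 add0r.
have f12 : pform (deriv_row p) (deriv_row (deriv_row p)) = 0.
  have := pform_deriv (deriv_row p) (deriv_row p);
    rewrite null1 // linear0 pformC.
  by rewrite -mulr2n -mulr_natl => /esym/eqP;
    rewrite mulf_eq0 -polyC_natr polyC_eq0 pnatr_eq0 /= => /eqP.
have f03 : pform p (deriv_row (deriv_row (deriv_row p))) = 0.
  by have := pform_deriv p (deriv_row (deriv_row p));
    rewrite f02 f12 linear0 add0r.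
have f13 : pform (deriv_row p) (deriv_row (deriv_row (deriv_row p))) = - osc p.
  have /esym/eqP := pform_deriv (deriv_row p) (deriv_row (deriv_row p)).
  by rewrite f12 linear0 addrC addr_eq0 => /eqP.
have f04 : pform p (deriv_row (deriv_row (deriv_row (deriv_row p)))) = osc p.
  have /esym/eqP := pform_deriv p (deriv_row (deriv_row (deriv_row p))).
  by rewrite f03 linear0 addrC addr_eq0 f13 opprK => /eqP.
have f22 : (osc p)^`() = 2 * pform (deriv_row (deriv_row p))
  (deriv_row (deriv_row (deriv_row p))).
  by rewrite pform_deriv pformC mulr_natl mulr2n.
have f14 : pform (deriv_row p) (deriv_row (deriv_row (deriv_row (deriv_row p))))
  = - (3 * pform (deriv_row (deriv_row p))
    (deriv_row (deriv_row (deriv_row p)))).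
  have := pform_deriv (deriv_row p) (deriv_row (deriv_row (deriv_row p)));
    rewrite f13 linearN /= f22 => /eqP.
  rewrite -subr_eq0 => /eqP E; apply/eqP;
    rewrite -subr_eq0 -oppr_eq0 -[X in _ == X]E.
  by apply/eqP; ring.
have ev0 q r : pform q r = 0 -> form (eval_row q t) (eval_row r t) = 0.
  by rewrite -pform_eval => ->; rewrite horner0.
have [a [c E]] : exists a c, eval_row (deriv_row (deriv_row p)) t =
  a *: eval_row p t + c *: eval_row (deriv_row p) t.
  apply: (isotropic_plane_orth (null_free np (z := t))); try exact: ev0.
  - exact/ev0/null0.
  - exact/ev0/null1.
  - by rewrite -pform_eval.
have f23 : (pform (deriv_row (deriv_row p))
  (deriv_row (deriv_row (deriv_row p)))).[t] = 0.
  rewrite pform_eval E formDl !formZl -!pform_eval f03 f13 hornerN rt horner0;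
    ring.
split; first by rewrite f22 hornerM f23 mulr0.
rewrite pform_eval E formDl !formZl -!pform_eval f04 f14 rt hornerN hornerM f23;
  ring.
Qed.

Lemma gram_no_free6 (v : 'I_6 -> 'rV[K]_5) : exists2 c : 'I_6 -> K,
  exists i, c i != 0 & forall w, \sum_i c i * form (v i) w = 0.
Proof.
pose A : 'M[K]_(6, 5) := \matrix_i v i.
have : ~~ row_free A by rewrite /row_free neq_ltn ltnS rank_leq_col.
rewrite -kermx_eq0 => /rowV0Pn[c /sub_kermxP cA c0].
exists (c 0).
  apply/existsP; apply: contraT; rewrite negb_exists => /forallP h.
  case/negP: c0; apply/eqP/rowP => i; rewrite mxE; apply/eqP.
  by have := h i; rewrite negbK.
move=> w; transitivity (form (c *m A) w); last by rewrite cA form0l.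
rewrite mulmx_sum_row /form !mulmx_suml summxE.
by apply: eq_bigr => i _; rewrite rowK -!scalemxAl [RHS]mxE.
Qed.

Lemma immersed_null_osc_eq0 p : immersed_null p -> osc p = 0.
Proof.
move=> gp; apply/eqP; apply: contraT => h0.
have [{gp h0}q [gq h0 k22 k55]] := exists_roots_zero_infty gp h0.
have [np _] := gq; have [nr _] := immersed_null_reverse gq.
have k33 := gram33_neq0 gq h0 k22.
have k44 : gram q 4 4 != 0.
  have := gram33_neq0 (immersed_null_reverse gq) (osc_reverse_neq0 gq h0).
  by rewrite !gram_reverse // => /(_ k55).
have lo i j : (i + j <= 5)%N -> gram q i j = 0 by exact: gram_low5.
have hi i j : (9 <= i + j)%N -> gram q i j = 0 by exact: gram_high.
have [_ _ _ [k24 k15 k06]] := gram_at_zero np k22.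
have [k35 k26 k17] := gram_infty np nr k55.
have [k16 k07] := gram_deg7 np.
have h5 := osc_size np nr k55.
(* Double roots at 0 and at infinity leave only the coefficients of degrees 2, 3 and 4. *)
have hE t : (osc q).[t] = 36 * gram q 3 3 * t ^+ 2
    + (80 * gram q 2 5 + 144 * gram q 3 4) * t ^+ 3 + 36 * gram q 4 4 * t ^+ 4.
  rewrite (horner_coef_wide _ h5) -(big_mkord xpredT
    (fun i => (osc q)`_i * t ^+ i)).
  rewrite unlock /= !osc_coef unlock /subn /= /muln /=.
  rewrite !(gramC q 6 _) !(gramC q 5 _) !(gramC q 4 _) !(gramC q 3 2) k24 k26
    k35 k22 (lo 2 3) //. by field.
pose m := 80 * gram q 2 5 + 144 * gram q 3 4.
have hP : osc q = (36 * gram q 3 3) *: 'X^2 + m *: 'X^3 + (36 * gram q 4 4) *: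
  'X^4.
  apply/eqP; rewrite -subr_eq0; apply/eqP/poly_eq0 => w _.
  by rewrite !(hornerD, hornerN, hornerC, hornerZ, hornerMn, hornerX, hornerXn)
    hE /m; ring.
have h4size : (size (osc4 q) <= 3)%N.
  apply/leq_sizeP => n n3; rewrite osc4_coef big_nat big1 // => i /andP[_ ni].
  by rewrite hi ?mulr0 //; lia.
have h4E t : (osc4 q).[t] =
    (240 * gram q 2 5 + 144 * gram q 3 4) * t - 360 * gram q 4 4 * t ^+ 2.
  rewrite (horner_coef_wide _ h4size) -(big_mkord xpredT
    (fun i => (osc4 q)`_i * t ^+ i)).
  rewrite unlock /= !osc4_coef unlock /subn /= /muln /=.
  by rewrite k24 k26 k35; field.
(* [g] is [q / z^2]; its root is the third root of [q], and it is not 0 because [gram q 3 3] is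
   not. *)
pose g : {poly K} := (36 * gram q 3 3)%:P + m *: 'X + (36 * gram q 4 4) *: 'X^2.
have [t /rootP rt] : exists t, root g t.
  apply/closed_rootP; apply: contra k44 => /eqP sz.
  have : g`_2 = 0 by rewrite nth_default // sz.
  rewrite !coefE /= !mulr0 !addr0 add0r mulr1 => /eqP.
  by rewrite mulf_eq0 pnatr_eq0.
have t0 : t != 0.
  apply: contra k33 => /eqP t0; move/eqP: rt;
    rewrite t0 !(hornerD, hornerN, hornerC, hornerZ, hornerMn, hornerX,
      hornerXn).
  by rewrite expr0n /= !mulr0 !addr0 mulf_eq0 pnatr_eq0.
have gt : 36 * gram q 3 3 + m * t + 36 * gram q 4 4 * t ^+ 2 = 0.
  by rewrite -[RHS]rt !(hornerD, hornerN, hornerC, hornerZ, hornerMn, hornerX,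
    hornerXn).
have [|dt St] := @osc_root q t np.
  by apply/rootP; rewrite hE -/m -[RHS](mulr0 (t ^+ 2)) -gt; ring.
have {}dt : 72 * gram q 3 3 + 3 * m * t + 144 * gram q 4 4 * t ^+ 2 = 0.
  apply: (mulfI t0); rewrite mulr0 -[RHS]dt hP !poly.derivE
    !(hornerD, hornerN, hornerC, hornerZ, hornerMn, hornerX, hornerXn) /=; ring.
have {}St : 240 * gram q 2 5 + 144 * gram q 3 4 - 360 * gram q 4 4 * t = 0.
  by apply: (mulfI t0); rewrite mulr0 -[RHS]St h4E; ring.
(* Together with [e33] this identifies [q] with [36 * gram q 4 4 * z^2 * (z - t)^2]. *)
have mE : m = - (72 * gram q 4 4 * t).
  apply: (mulfI t0); apply: (lincomb2 1 (- 2) dt gt); ring.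
have e33 : gram q 3 3 = gram q 4 4 * t ^+ 2.
  by apply: (lincomb1 36^-1 gt); rewrite mE; field.
have mE0 : m + 72 * gram q 4 4 * t = 0 by rewrite mE addNr.
(* The value of [m] and the equation from [osc4] are two independent equations for [gram q 2 5] and
   [gram q 3 4]. *)
have e25 : gram q 2 5 = 27 / 10 * (gram q 4 4 * t).
  by apply: (lincomb2 160^-1 (- 160^-1) St mE0); rewrite /m; field.
have e34 : gram q 3 4 = - (2 * (gram q 4 4 * t)).
  by apply: (lincomb1 144^-1 mE0); rewrite /m e25; field.
pose s := gram q 4 4 * t; have s0 : s != 0 by rewrite mulf_neq0.
have e16 : gram q 1 6 = - (s / 2) by rewrite k16 e25 e34 /s; field.
have e07 : gram q 0 7 = - (s / 5) by rewrite k07 e25 e34 /s; field.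
(* [P_2] and [P_5] are left out: they lie in the span of [P_0], [P_1] and of [P_6], [P_7]
   respectively. *)
have [c [i ci] cP] := gram_no_free6 (fun i => coef_row q
  (nth 0%N [:: 0; 1; 3; 4; 6; 7]%N i)).
have {}cP j : \sum_(i < 6) c i * gram q (nth 0%N [:: 0; 1; 3; 4; 6; 7]%N i) j =
  0 := cP _.
have := cP 0%N; have := cP 1%N; have := cP 3%N; have := cP 4%N; have := cP 6%N;
  have := cP 7%N.
rewrite !big_ord_recl !big_ord0 /= /bump /=.
rewrite (gramC q 4 3) (gramC q 6 1) (gramC q 7 1) (gramC q 6 0) (gramC q 7 0).
rewrite (hi 3 7)%N // (hi 4 7)%N // (hi 6 7)%N // (hi 7 7)%N // (hi 3 6)%N //.
rewrite (hi 4 6)%N // (hi 6 6)%N // (hi 7 6)%N // (hi 6 4)%N // (hi 7 4)%N //.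
rewrite (hi 6 3)%N // (hi 7 3)%N // (lo 0 4)%N // (lo 1 4)%N // (lo 0 3)%N //.
rewrite (lo 1 3)%N // (lo 0 1)%N // (lo 1 1)%N // (lo 3 1)%N // (lo 4 1)%N //.
rewrite (lo 0 0)%N // (lo 1 0)%N // (lo 3 0)%N // (lo 4 0)%N //.
rewrite !mulr0 !addr0 !add0r k17 k06 e33 e34 e16 e07 => p7 p6 p4 p3 p1 p0.
have solve2 (a b c' d x y : K) : x * a + y * b = 0 -> x * c' + y * d = 0 ->
    a * d - b * c' != 0 -> x = 0 /\ y = 0.
  move=> h1 h2 h; split; apply: (mulfI h); rewrite mulr0.
    by apply: (lincomb2 d (- b) h1 h2); ring.
  by apply: (lincomb2 (- c') a h1 h2); ring.
(* The Gram matrix splits into the blocks pairing indices 0, 1 with 6, 7 and 3, 4 with themselves.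
   Their determinants are [3 / 50 * s ^+ 2] and [- 3 * s ^+ 2], up to the order of rows. *)
have s2 : s ^+ 2 != 0 by rewrite expf_neq0.
have [|c0 c1] := solve2 _ _ _ _ _ _ p7 p6.
  rewrite (_ : _ - _ = - (3 / 50 * s ^+ 2)); last by rewrite /s; field.
  by rewrite oppr_eq0 !mulf_neq0 ?invr_eq0 ?pnatr_eq0.
have [|c2 c3] := solve2 _ _ _ _ _ _ p4 p3.
  rewrite (_ : _ - _ = 3 * s ^+ 2); last by rewrite /s; ring.
  by rewrite mulf_neq0 ?pnatr_eq0.
have [|c4 c5] := solve2 _ _ _ _ _ _ p1 p0.
  rewrite (_ : _ - _ = - (3 / 50 * s ^+ 2)); last by rewrite /s; field.
  by rewrite oppr_eq0 !mulf_neq0 ?invr_eq0 ?pnatr_eq0.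
case/eqP: ci; case: i => [[|[|[|[|[|[|i]]]]]] hi'] //.
- by rewrite -[RHS]c0; congr c; apply: val_inj.
- by rewrite -[RHS]c1; congr c; apply: val_inj.
- by rewrite -[RHS]c2; congr c; apply: val_inj.
- by rewrite -[RHS]c3; congr c; apply: val_inj.
- by rewrite -[RHS]c4; congr c; apply: val_inj.
- by rewrite -[RHS]c5; congr c; apply: val_inj.
Qed.

End NullPolynomials.

(** * From holomorphic curves to polynomials *)

Section Coordinates.
Local Open Scope classical_set_scope.
Local Open Scope ring_scope.
Variable R : realType.
Local Notation C := (cplx R).
Implicit Types (G : C -> 'rV[C]_5) (F : C -> C) (z d w : C).

Lemma derive_coord G z j : derivable G z 1 ->
  is_derive z 1 (fun w => G w 0 j : C) ((derive1 G z) 0 j).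
Proof.
move=> dG; have cv : h^-1 *: (G (h *: 1 + z) - G z) @[h --> 0^'] --> derive1 G
  z.
  by rewrite derive1E; exact: dG.
have cj : (h^-1 *: (G (h *: 1 + z) - G z)) 0 j @[h --> 0^'] --> (derive1 G z) 0
  j.
  apply: (cvg_comp _ (fun M : 'rV[C]_5 => M 0 j) cv); exact: coord_continuous.
have E : (fun h : C => (h^-1 *: (G (h *: 1 + z) - G z)) 0 j) =
   (fun h => h^-1 *: ((G (h *: 1 + z)) 0 j - G z 0 j)).
  by apply/funext => h; rewrite !mxE.
rewrite E in cj; apply: DeriveDef; first by apply/cvg_ex;
  exists (derive1 G z 0 j).
exact: (cvg_lim _ cj).
Qed.

Lemma derive_scale_vec F z d (v : 'rV[C]_5) : is_derive z 1 F d ->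
  is_derive z 1 (fun w => F w *: v) (d *: v).
Proof.
move=> [dF dE].
have cv : h^-1 *: (F (h *: 1 + z) - F z) @[h --> 0^'] --> d by rewrite -dE;
  exact: dF.
have cj : h^-1 *: (F (h *: 1 + z) *: v - F z *: v) @[h --> 0^'] --> d *: v.
  have E : (fun h : C => h^-1 *: (F (h *: 1 + z) *: v - F z *: v)) =
     (fun h => (h^-1 *: (F (h *: 1 + z) - F z)) *: v).
    by apply/funext => h; rewrite -scalerBl scalerA.
  rewrite E; apply: cvgZr_tmp; exact: cv.
apply: DeriveDef; first by apply/cvg_ex; exists (d *: v).
exact: (cvg_lim _ cj).
Qed.

Lemma derive_row G z (l : 'rV[C]_5) :
  (forall j, is_derive z 1 (fun w => G w 0 j : C) (l 0 j)) -> is_derive z 1 G l.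
Proof.
move=> h.
have -> : G = \sum_j (fun w => (G w 0 j) *: delta_mx 0 j).
  by apply/funext => w; rewrite fct_sumE [LHS]row_sum_delta.
rewrite [l]row_sum_delta; apply: is_derive_sum => j.
exact: derive_scale_vec.
Qed.

Lemma derive_horner (f : {poly C}) z :
  is_derive z 1 (fun w : C => f.[w] : C) (f^`()).[z].
Proof.
elim/poly_ind: f => [|f c IH].
  rewrite linear0 horner0 (_ : (fun w => _) = cst 0);
    first exact: is_derive_cst.
  by apply/funext => w; rewrite horner0.
have -> : (fun w : C => (f * 'X + c%:P).[w]) =
  ((fun w => f.[w]) * (id : C -> C)) + cst c.
  by apply/funext => w; rewrite !(hornerMX, hornerD, hornerC).
rewrite derivD derivC addr0 derivM derivX mulr1 hornerD hornerMX.
have dM := @is_deriveM C C _ _ z 1 _ _ IH (is_derive_id z 1).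
apply: is_derive_eq (is_deriveD dM (is_derive_cst c z 1)) _.
rewrite addr0 /=.
by rewrite [f.[z] *: 1]mulr1 [z *: _]mulrC addrC.
Qed.

Lemma derive_eval_row (p : 'rV[{poly C}]_5) z :
  is_derive z 1 (eval_row p) (eval_row (deriv_row p) z).
Proof.
apply: derive_row => j; rewrite mxE [X in X.[z]]mxE.
have -> : (fun w => eval_row p w 0 j) = (fun w => (p 0 j).[w]) by
  apply/funext => w; rewrite mxE.
exact: derive_horner.
Qed.

End Coordinates.

(** * The two charts of the projective line *)

Section Charts.
Local Open Scope classical_set_scope.
Local Open Scope ring_scope.
Variable R : realType.
Local Notation C := (cplx R).
Implicit Types (z w : C).

Lemma vline_scale (K : fieldType) (V : vectType K) (u v : V) a :
  a != 0 -> u = a *: v -> <[u]>%VS = <[v]>%VS.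
Proof.
move=> a0 ->; apply/eqP; rewrite eqEsubv -!memvE memvZ ?memv_line //=.
by rewrite -[X in X \in _](scalerK a0) memvZ // memv_line.
Qed.

Lemma vline_eq (K : fieldType) (V : vectType K) (u v : V) :
  u != 0 -> <[u]>%VS = <[v]>%VS -> exists2 a, a != 0 & u = a *: v.
Proof.
move=> u0 uv; have /vlineP[a E] : u \in <[v]>%VS by rewrite -uv memv_line.
by exists a => //; apply: contra u0 => /eqP a0; rewrite E a0 scale0r.
Qed.

Lemma chart_vec_neq0 i z : chart_vec i z != 0.
Proof.
by apply/eqP => /rowP/(_ i)/eqP; rewrite !mxE eqxx oner_eq0.
Qed.

Lemma chart_inj i : injective (@chart R i).
Proof.
move=> z w /(congr1 sval) /= /(vline_eq (chart_vec_neq0 i z))[a _ E].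
have := congr1 (fun v : 'rV_2 => v 0 i) E; rewrite !mxE eqxx mulr1 => a1.
have := congr1 (fun v : 'rV_2 => v 0 (lift i 0)) E.
by rewrite !mxE eq_sym (negPf (neq_lift i 0)) -a1 mul1r.
Qed.

Lemma chart0_inv z : z != 0 -> chart 0 z = chart 1 z^-1.
Proof.
move=> z0; apply: val_inj => /=; apply: (vline_scale z0).
apply/rowP => j; rewrite !mxE.
by case: j => [[|[|j]]] hj //=; rewrite ?mulr1 ?mulfV.
Qed.

Lemma chart0_neq_infty z : chart 0 z <> chart 1 0.
Proof.
move=> /(congr1 sval) /= /(vline_eq (chart_vec_neq0 0 z))[a _ E].
have /eqP := congr1 (fun v : 'rV_2 => v 0 0) E.
by rewrite !mxE /= mulr0 oner_eq0.
Qed.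

Lemma chart_cases (p : P1 R) : (exists z, p = chart 0 z) \/ p = chart 1 0.
Proof.
case: p => L dL; pose u : 'rV[C]_2 := vpick L.
have u0 : u != 0 by rewrite vpick0 -dimv_eq0 (eqP dL).
have Lu : L = <[u]>%VS.
  apply/esym/eqP; rewrite eqEdim -memvE memv_pick /= dim_vline u0 (eqP dL) //.
have uE : u = \row_j (if j == 0 then u 0 0 else u 0 1).
  by apply/rowP => j; rewrite mxE; case: j => [[|[|j]]] hj //=; congr (u _ _);
    apply: val_inj.
have [a0|a0] := eqVneq (u 0 0) 0; [right|left; exists (u 0 1 / u 0 0)];
  apply: val_inj => /=; rewrite Lu.
  apply: (@vline_scale _ _ _ _ (u 0 1)).
    by apply: contra u0 => /eqP a1; rewrite uE a0 a1; apply/eqP/rowP => j;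
      rewrite !mxE if_same.
  by rewrite [LHS]uE a0; apply/rowP => j; rewrite !mxE;
    case: j => [[|[|j]]] hj //=; rewrite ?mulr0 ?mulr1.
apply: (vline_scale a0); rewrite [LHS]uE; apply/rowP => j; rewrite !mxE.
by case: j => [[|[|j]]] hj //=; rewrite ?mulr1 // mulrC divfK.
Qed.

Lemma near_inv (P : C -> Prop) z : z != 0 -> (\forall w \near z^-1, P w) ->
  \forall w \near z, P w^-1.
Proof.
move=> z0 h; have : {for z, continuous (fun w : C => w^-1)}.
  by apply: continuousV => //; exact: cvg_id.
by move=> /(_ _ h).
Qed.

Lemma holo_inv (V : normedModType C) (F : C -> V) z : z != 0 ->
  holo_at F z^-1 -> holo_at (fun w => F w^-1) z.
Proof.
move=> z0 hF; have := near_inv z0 hF; have := near_neq z0.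
rewrite /holo_at => h1 h2; near=> w.
have w0 : w != 0 by near: w.
have /derivable1_diffP dF : derivable F w^-1 1 by near: w.
apply/derivable1_diffP.
apply: (differentiable_comp (f := fun w : C => w^-1 : C) _ dF).
apply/derivable1_diffP; apply: derivable_invf => //; exact: derivable_id.
Unshelve. all: by end_near. Qed.

End Charts.

(** * Lifts adapted to a hyperplane *)

Section AdaptedLifts.
Local Open Scope classical_set_scope.
Local Open Scope ring_scope.
Variable R : realType.
Local Notation C := (cplx R).
Variables (g : P1 R -> PW R) (c : 'cV[C]_5).
Implicit Types (z w : C) (G : C -> 'rV[C]_5) (h : C -> C).

(* The lift [G] meets the hyperplane [c] to order exactly [k] at [z0]. *)
Definition adapted i z0 k G h :=
  [/\ local_lift g i z0 G, holo_at h z0, h z0 != 0 &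
      \forall z \near z0, (G z *m c) 0 0 = (z - z0) ^+ k * h z].

Lemma holo_mul h h' z : holo_at h z -> holo_at h' z ->
  holo_at (fun w => h w * h' w) z.
Proof.
move=> dh dh'.
exact: (@filterS2 _ (nbhs z) _ _ _ _ (fun w d1 d2 => derivable_mulf d1 d2) dh
  dh').
Qed.

Lemma holo_at_horner (f : {poly C}) z : holo_at (fun w => f.[w] : C) z.
Proof.
have d w : derivable (fun w => f.[w] : C) w 1 by case: (derive_horner f w).
exact: (@filterE _ (nbhs z) _ _ d).
Qed.

Lemma holo_linear_form G z : holo_at G z ->
  holo_at (fun w => (G w *m c) 0 0 : C) z.
Proof.
move=> hG; suff sub (w : C) : derivable G w 1 ->
  derivable (fun w => (G w *m c) 0 0 : C) w 1.
  exact: (@filterS _ (nbhs z) _ _ _ sub hG).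
move=> dG.
have -> : (fun w => (G w *m c) 0 0) = \sum_j (fun w => G w 0 j * c j 0 : C).
  by apply/funext => v; rewrite fct_sumE mxE.
apply: derivable_sum => j; apply: derivable_mulf; last exact: derivable_cst.
by case: (derive_coord j dG).
Qed.

Lemma in_hyperplaneP i z G : local_lift g i z G ->
  in_hyperplane c (g (chart i z)) <-> (G z *m c) 0 0 = 0.
Proof.
move=> [_ /nbhs_singleton[_ gG]]; split=> [h|h w].
  by rewrite h ?mxE // gG memv_line.
rewrite gG => /vlineP[a ->]; rewrite -scalemxAl; apply/matrixP => x y.
by rewrite !ord1 mxE h mulr0 mxE.
Qed.

Lemma adapted_off i z : holomorphic_curve g ->
  ~ in_hyperplane c (g (chart i z)) -> exists G h, adapted i z 0 G h.
Proof.
move=> hg nin; have [G lG] := hg i z.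
exists G, (fun w => (G w *m c) 0 0); split=> //.
- by apply: holo_linear_form; case: lG.
- by apply/eqP => E; apply: nin; apply/(in_hyperplaneP lG).
- have e w : (G w *m c) 0 0 = (w - z) ^+ 0 * (G w *m c) 0 0 by rewrite expr0
    mul1r.
  exact: (@filterE _ (nbhs z) _ _ e).
Qed.

Lemma adapted_chart0 z k G h : z != 0 -> adapted 1 z^-1 k G h ->
  exists G' h', adapted 0 z k G' h'.
Proof.
move=> z0 [[hG lG] hh hz Gh].
(* Since [w^-1 - z^-1 = - (w * z)^-1 * (w - z)], the [k]-th power of the first factor is absorbed
   into the unit [h]. *)
exists (fun w => G w^-1), (fun w => (- (w * z)^-1) ^+ k * h w^-1); split.
- split; first exact: holo_inv.
  have h1 := near_neq z0; have h2 := near_inv z0 lG; near=> w.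
  have w0 : w != 0 by near: w.
  by rewrite chart0_inv //; near: w.
- apply: holo_mul; last exact: (@holo_inv R C h z z0 hh).
  pose q : {poly C} := ((- z^-1) *: 'X) ^+ k.
  have -> : (fun w => (- (w * z)^-1) ^+ k) = (fun w => q.[w^-1]).
    by apply/funext => w; rewrite horner_exp hornerZ hornerX invfM mulrC mulNr.
  exact: (@holo_inv R C (fun v => q.[v] : C) z z0 (holo_at_horner q _)).
- by rewrite mulf_neq0 // expf_neq0 // oppr_eq0 invr_eq0 mulf_neq0.
have h1 := near_neq z0; have h2 := near_inv z0 Gh; near=> w.
have w0 : w != 0 by near: w.
have -> : (G w^-1 *m c) 0 0 = (w^-1 - z^-1) ^+ k * h w^-1 by near: w.
rewrite mulrA -exprMn; congr (_ ^+ _ * _); field.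
by rewrite w0 z0.
Unshelve. all: by end_near. Qed.

Lemma adapted_mult0 z k : multiplicity g c (chart 0 z) k ->
  exists G h, adapted 0 z k G h.
Proof.
move=> [i [z1 [G [h [E lG hh hz Gh]]]]].
have [i0|i1] : i = 0 \/ i = 1.
  by case: i {E lG} => [[|[|i]]] hi //; [left|right]; apply: val_inj.
  rewrite i0 in E lG; have zz := chart_inj E; rewrite -zz in lG hh hz Gh.
  by exists G, h.
rewrite i1 in E lG; have [z0|z0] := eqVneq z1 0.
  by rewrite z0 in E; case: (chart0_neq_infty E).
have E1 : z = z1^-1.
  apply: (@chart_inj R 0); rewrite E chart0_inv ?invr_eq0 // invrK //.
have z0' : z != 0 by rewrite E1 invr_eq0.
have A : adapted 1 z^-1 k G h by rewrite E1 invrK.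
exact: (adapted_chart0 z0' A).
Qed.

Lemma adapted_mult_infty k : multiplicity g c (chart 1 0) k ->
  exists G h, adapted 1 0 k G h.
Proof.
move=> [i [z1 [G [h [E lG hh hz Gh]]]]].
have [i0|i1] : i = 0 \/ i = 1.
  by case: i {E lG} => [[|[|i]]] hi //; [left|right]; apply: val_inj.
  by rewrite i0 in E; case: (@chart0_neq_infty R z1).
rewrite i1 in E lG; have zz := chart_inj E; rewrite -zz in lG hh hz Gh.
by exists G, h.
Qed.

(** The divisor is split into its finite part and infinity. The multiplicity 0 off the divisor lets
    adapted lifts exist at every point, not only on the hyperplane. *)
Lemma degree_data (s : seq (P1 R)) (m : P1 R -> nat) :
  holomorphic_curve g -> uniq s ->
  (forall p, p \in s <-> in_hyperplane c (g p)) ->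
  (forall p, p \in s -> multiplicity g c p (m p)) ->
  exists (Z : seq C) (k : C -> nat) (k1 : nat),
    [/\ uniq Z, forall z, z \notin Z -> k z = 0%N,
        (\sum_(z <- Z) k z + k1 = \sum_(p <- s) m p)%N,
        forall z, exists G h, adapted 0 z (k z) G h &
        exists G h, adapted 1 0 k1 G h].
Proof.
move=> hg us sP mP; pose inf : P1 R := chart 1 0.
have /choice[co coP] : forall p : P1 R, exists z, p != inf -> p = chart 0 z.
  move=> p; have [[z ->]|->] := chart_cases p; first by exists z.
  by exists 0; rewrite eqxx.
pose k z := if chart 0 z \in s then m (chart 0 z) else 0%N.
pose k1 := if inf \in s then m inf else 0%N.
pose s' := [seq p <- s | p != inf].
exists [seq co p | p <- s'], k, k1; split.
- rewrite map_inj_in_uniq ?filter_uniq // => p q.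
  by rewrite !mem_filter => /andP[/coP pE _] /andP[/coP qE _] E;
    rewrite pE qE E.
- move=> z zZ; rewrite /k ifN //; apply: contra zZ => zs; apply/mapP.
  have ninf : chart 0 z != inf by apply/eqP; exact: chart0_neq_infty.
  exists (chart 0 z); first by rewrite mem_filter zs andbT.
  by apply: (@chart_inj R 0); rewrite -coP.
- rewrite big_map big_filter [RHS](bigID (fun p => p != inf)) /=;
    congr (_ + _)%N.
    rewrite [LHS]big_seq_cond [RHS]big_seq_cond;
      apply: eq_bigr => p /andP[ps pinf].
    by rewrite /k -coP // ps.
  under [RHS]eq_bigl do rewrite negbK; rewrite /k1.
  case: ifP => [infs|ninfs]; first by rewrite -big_filter
    (filter_pred1_uniq us infs) big_seq1.
  rewrite big_seq_cond big1 // => p /andP[ps /eqP pE].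
  by rewrite -pE ps in ninfs.
- move=> z; rewrite /k; case: ifP => [zs|/negP zs];
    first exact/adapted_mult0/mP.
  by apply: adapted_off => // /sP.
- rewrite /k1; case: ifP => [zs|/negP zs]; first exact/adapted_mult_infty/mP.
  by apply: adapted_off => // /sP.
Qed.

End AdaptedLifts.

(** * Gluing the local lifts into a polynomial vector *)

Section PolynomialLift.
Local Open Scope classical_set_scope.
Local Open Scope ring_scope.
Variable R : realType.
Local Notation C := (cplx R).
Implicit Types (z w : C).

Lemma near_avoid (Z : seq C) z0 : \forall z \near z0, z = z0 \/ z \notin Z.
Proof.
elim: Z => [|a Z IH]; first by apply: (@filterE _ (nbhs z0)) => z; right.
have [az|/near_neq az] := eqVneq z0 a.
  apply: filterS IH => z [->|zZ]; first by left.
  have [->|za] := eqVneq z z0; first by left.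
  by right; rewrite inE negb_or -az za.
apply: filterS2 az IH => z za [->|zZ]; first by left.
by right; rewrite inE negb_or za.
Qed.

Variables (g : P1 R -> PW R) (c : 'cV[C]_5) (Z : seq C) (k : C -> nat)
  (k1 : nat).
Hypotheses (Z_uniq : uniq Z) (k_off : forall z, z \notin Z -> k z = 0%N)
  (degree7 : (\sum_(z <- Z) k z + k1 = 7)%N).
Variables (G0 : C -> C -> 'rV[C]_5) (h0 : C -> C -> C).
Hypothesis adapted0 : forall z, adapted g c 0 z (k z) (G0 z) (h0 z).
Variables (G1 : C -> 'rV[C]_5) (h1 : C -> C).
Hypothesis adapted1 : adapted g c 1 0 k1 G1 h1.

Definition divisor_poly : {poly C} := \prod_(z <- Z) ('X - z%:P) ^+ k z.
Definition divisor_poly_off z0 : {poly C} :=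
  \prod_(z <- Z | z != z0) ('X - z%:P) ^+ k z.

Lemma divisor_poly_split z0 :
  divisor_poly = ('X - z0%:P) ^+ k z0 * divisor_poly_off z0.
Proof.
have [zZ|zZ] := boolP (z0 \in Z); first by rewrite /divisor_poly (bigD1_seq z0).
rewrite k_off // expr0 mul1r /divisor_poly /divisor_poly_off.
rewrite big_seq [RHS]big_seq_cond; apply: eq_bigl => z.
by have [zs|//] := boolP (z \in Z); apply/esym; apply: contraNneq zZ => <-.
Qed.

Lemma divisor_poly_off_neq0 z0 : (divisor_poly_off z0).[z0] != 0.
Proof.
rewrite horner_prod prodf_seq_neq0; apply/allP => z _; apply/implyP => zz.
by rewrite horner_exp expf_neq0 // hornerXsubC subr_eq0 eq_sym.
Qed.

(** This is the lift whose image under the linear form [c] is [divisor_poly]: the local lift is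
    divided by its own image and multiplied by [divisor_poly], after cancelling the common power of
    [X - z], so that points of [Z] are included. *)
Definition global_lift z : 'rV[C]_5 := ((divisor_poly_off z).[z] / h0 z z) *: G0
  z z.

Lemma lift_line z : global_lift z != 0 /\ line (g (chart 0 z)) =
  <[global_lift z]>%VS.
Proof.
have [[_ /nbhs_singleton[Gz gz]] _ hz _] := adapted0 z.
have a0 : (divisor_poly_off z).[z] / h0 z z != 0.
  by rewrite mulf_neq0 ?invr_eq0 // divisor_poly_off_neq0.
split; first by rewrite /global_lift scaler_eq0 negb_or a0.
by rewrite gz; apply/esym; apply: vline_scale a0 _.
Qed.

(** Off [Z] a vector of the line is determined by its image under [c], so the choice of local lift
    does not matter. *)
Lemma lift_off z (G : 'rV[C]_5) : z \notin Z -> G != 0 ->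
  line (g (chart 0 z)) = <[G]>%VS ->
  (G *m c) 0 0 != 0 /\ global_lift z = (divisor_poly.[z] / (G *m c) 0 0) *: G.
Proof.
move=> zZ Gz gG; have [[_ /nbhs_singleton[Gz' gz]] _ hz /nbhs_singleton hc] :=
  adapted0 z.
have [a a0 E] : exists2 a, a != 0 & G0 z z = a *: G.
  by apply: vline_eq => //; rewrite -gz.
rewrite subrr k_off // expr0 mul1r E -scalemxAl mxE in hc.
have c0 : (G *m c) 0 0 != 0.
  by apply: contra hz => /eqP c0; rewrite -hc c0 mulr0.
split=> //; rewrite /global_lift E -hc scalerA (divisor_poly_split z) k_off //
  expr0 mul1r.
congr (_ *: _); field; by rewrite a0 c0.
Qed.

(** [global_lift] uses a different chosen lift at each point; near [z0] all of them agree with the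
    single holomorphic lift [G0 z0], which yields differentiability. *)
Lemma lift_local z0 : \forall z \near z0,
  global_lift z = ((divisor_poly_off z0).[z] / h0 z0 z) *: G0 z0 z.
Proof.
have [[_ lG] _ hz hc] := adapted0 z0.
have av := near_avoid Z z0; near=> z.
have [->|zz] := eqVneq z z0; first by [].
have zZ : z \notin Z.
  have [E|//] : z = z0 \/ z \notin Z by near: z.
  by rewrite E eqxx in zz.
have [Gz gz] : G0 z0 z != 0 /\ line (g (chart 0 z)) = <[G0 z0 z]>%VS by near: z.
have E : (G0 z0 z *m c) 0 0 = (z - z0) ^+ k z0 * h0 z0 z by near: z.
have [c0 ->] := lift_off zZ Gz gz; rewrite E (divisor_poly_split z0).
rewrite E mulf_eq0 negb_or in c0; case/andP: c0 => p0 hz0.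
rewrite hornerM horner_exp hornerXsubC; congr (_ *: _); field.
by rewrite p0 hz0.
Unshelve. all: by end_near. Qed.

Lemma lift_derivable z0 j : derivable (fun z => global_lift z 0 j : C) z0 1.
Proof.
have [[hG _] hh hz _] := adapted0 z0.
have dG := nbhs_singleton hG; have dh := nbhs_singleton hh.
have [dGj _] := derive_coord j dG.
have [dD _] := derive_horner (divisor_poly_off z0) z0.
have d1 := derivable_mulf (derivable_mulf dD (derivable_invf hz dh)) dGj.
apply: near_derivable d1; have := lift_local z0.
by apply: filterS => z ->; rewrite mxE.
Qed.

Definition divisor_poly_infty : {poly C} := \prod_(z <- Z) (1 - z *: 'X) ^+ k z.

Definition lift_infty w : 'rV[C]_5 := (divisor_poly_infty.[w] / h1 w) *: G1 w.

Lemma divisor_poly_inv w : w != 0 ->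
  w ^+ (\sum_(z <- Z) k z) * divisor_poly.[w^-1] = divisor_poly_infty.[w].
Proof.
move=> w0; rewrite !horner_prod -prodrXr -big_split; apply: eq_bigr => z _ /=.
rewrite !horner_exp -exprMn hornerXsubC !(hornerD, hornerN, hornerZ, hornerC,
  hornerX).
by rewrite mulrBr mulfV // [w * z]mulrC.
Qed.

Lemma lift_infty_line : lift_infty 0 != 0 /\ line (g (chart 1 0)) =
  <[lift_infty 0]>%VS.
Proof.
have [[_ /nbhs_singleton[Gz gz]] _ hz _] := adapted1.
have D0 : divisor_poly_infty.[0] = 1.
  rewrite horner_prod big1 // => z _; rewrite horner_exp.
  by rewrite !(hornerD, hornerN, hornerZ, hornerC, hornerX) mulr0 subr0 expr1n.
have a0 : divisor_poly_infty.[0] / h1 0 != 0 by rewrite D0 mul1r invr_eq0.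
split; first by rewrite /lift_infty scaler_eq0 negb_or a0.
by rewrite gz; apply/esym; apply: vline_scale a0 _.
Qed.

(** The degree enters here: of the factor [w ^+ 7], the part of exponent the sum of [k] reverses
    [divisor_poly], and the remaining [w ^+ k1] cancels the zero of the image of [G1] under [c]. *)
Lemma lift_infty_local : \forall w \near (0 : C),
  w != 0 -> w ^+ 7 *: global_lift w^-1 = lift_infty w.
Proof.
have [[_ lG] _ hz hc] := adapted1.
have av := near_avoid [seq z^-1 | z <- Z] 0; near=> w; move=> w0.
have wZ : w^-1 \notin Z.
  have [E|zZ] : w = 0 \/ w \notin [seq z^-1 | z <- Z] by near: w.
    by rewrite E eqxx in w0.
  by apply: contra zZ => wZ; apply/mapP; exists w^-1; rewrite ?invrK.
have [Gz gz] : G1 w != 0 /\ line (g (chart 1 w)) = <[G1 w]>%VS by near: w.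
have E : (G1 w *m c) 0 0 = (w - 0) ^+ k1 * h1 w by near: w.
rewrite subr0 in E.
have gz' : line (g (chart 0 w^-1)) = <[G1 w]>%VS.
  by rewrite chart0_inv ?invr_eq0 // invrK.
have [c0 ->] := lift_off wZ Gz gz'.
rewrite E mulf_eq0 negb_or in c0; case/andP: c0 => p0 hw0.
rewrite /lift_infty -divisor_poly_inv // scalerA E -degree7 exprD;
  congr (_ *: _).
by field; rewrite p0 hw0.
Unshelve. all: by end_near. Qed.

Lemma lift_infty_derivable j : derivable (fun w => lift_infty w 0 j : C) 0 1.
Proof.
have [[hG _] hh hz _] := adapted1.
have dG := nbhs_singleton hG; have dh := nbhs_singleton hh.
have [dGj _] := derive_coord j dG.
have [dD _] := derive_horner divisor_poly_infty 0.
have d1 := derivable_mulf (derivable_mulf dD (derivable_invf hz dh)) dGj.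
by apply: near_derivable d1; apply: (@filterE _ (nbhs (0 : C))) => z;
  rewrite mxE.
Qed.

Lemma derivable_continuous_at (F : C -> C) z : derivable F z 1 ->
  {for z, continuous F}.
Proof. by move=> /derivable1_diffP/differentiable_continuous. Qed.

(** [lift_infty] is bounded near 0, so the lift grows at most like [|z|^7]; the exponent 8 accounts
    for the extra factor [nrm z]. *)
Lemma lift_growth j : exists A B : R, forall z, B <= nrm z ->
  nrm (global_lift z 0 j) * nrm z <= A * nrm z ^+ 8.
Proof.
have /continuous_nrm/(_ 1 ltr01)[r r0 h] :=
  derivable_continuous_at (@lift_infty_derivable j).
have /near_nrm[r' r'0 h'] := lift_infty_local.
exists (nrm (lift_infty 0 0 j) + 1), (2 / r + 2 / r') => z Bz.
have r1 : 0 < 2 / r by rewrite divr_gt0.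
have r2 : 0 < 2 / r' by rewrite divr_gt0.
have z0 : 0 < nrm z by lra.
have zn : z != 0 by rewrite -nrm_gt0.
have small s : 0 < s -> 2 / s <= nrm z -> nrm (z^-1 - 0) < s.
  move=> s0 sz; rewrite subr0 nrmV invf_plt ?posrE //.
  by apply: lt_le_trans sz; rewrite ltr_pdivlMr // mulVf ?gt_eqF //; lra.
have {}h := h z^-1 (small _ r0 _); have {}h' := h' z^-1 (small _ r'0 _).
have E : lift_infty z^-1 = z^-1 ^+ 7 *: global_lift z.
  by rewrite -h' ?invr_eq0 // ?invrK //; lra.
have {}h : nrm (lift_infty z^-1 0 j - lift_infty 0 0 j) < 1 by apply: h; lra.
rewrite E mxE in h.
have k7 : nrm (z^-1 ^+ 7 * global_lift z 0 j) <= nrm (lift_infty 0 0 j) + 1.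
  have := nrmD (z^-1 ^+ 7 * global_lift z 0 j - lift_infty 0 0 j)
    (lift_infty 0 0 j).
  by rewrite subrK; lra.
rewrite nrmM nrmX nrmV exprVn mulrC ler_pdivrMr ?exprn_gt0 // in k7.
by rewrite exprSr mulrA ler_wpM2r // ltW.
Qed.

Lemma lift_polynomial : exists p : 'rV[{poly C}]_5,
  (forall j, (size (p ord0 j) <= 8)%N) /\ forall z, eval_row p z =
    global_lift z.
Proof.
have /choice[q qP] : forall j : 'I_5, exists q : {poly C},
    (size q <= 8)%N /\ forall z, global_lift z 0 j = q.[z].
  move=> j; have [A [B gr]] := lift_growth j.
  have [||q sq qE] := @polynomial_of_growth R 8 (fun z => global_lift z 0 j)
    [::] A B _ _ gr.
  - by move=> z; apply: derivable_continuous_at; exact: lift_derivable.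
  - by move=> z _; exact: lift_derivable.
  by exists q.
exists (\row_j q j); split=> [j|z]; first by rewrite mxE; case: (qP j).
by apply/rowP => j; have [_ ->] := qP j; rewrite mxE [X in X.[z]]mxE.
Qed.

Lemma lift_charts : exists p : 'rV[{poly C}]_5, [/\
  forall j, (size (p ord0 j) <= 8)%N,
  forall z, eval_row p z != 0 /\ line (g (chart 0 z)) = <[eval_row p z]>%VS &
  forall w, eval_row (reverse p) w != 0 /\ line (g (chart 1 w)) =
    <[eval_row (reverse p) w]>%VS].
Proof.
have [p [sz pE]] := lift_polynomial; exists p; split=> // [z|w].
  by rewrite pE; exact: lift_line.
have revE w' : w' != 0 -> eval_row (reverse p) w' =
  w' ^+ 7 *: global_lift w'^-1.
  by move=> w0; rewrite -pE; apply/rowP => j; rewrite !mxE horner_reverse.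
have [->|w0] := eqVneq w 0; last first.
  have [l0 gl] := lift_line w^-1; have w7 : w ^+ 7 != 0 by rewrite expf_neq0.
  rewrite revE //; split; first by rewrite scaler_eq0 negb_or w7.
  rewrite -[in chart 1 w](invrK w) -chart0_inv ?invr_eq0 // gl.
  by apply/esym; apply: vline_scale w7 _.
(* Both maps are continuous at 0 and agree at small nonzero [w], so they agree at 0; a gap [e] is
   refuted at the sample point [v]. *)
suff -> : eval_row (reverse p) 0 = lift_infty 0 by exact: lift_infty_line.
apply/rowP => j; rewrite [LHS]mxE.
have c1 := derivable_continuous_at (@lift_infty_derivable j).
have [d2 _] := derive_horner (reverse p 0 j) 0.
have c2 := derivable_continuous_at d2.
apply/eqP; rewrite -subr_eq0 -nrm_eq0 eq_le nrm_ge0 andbT leNgt;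
  apply/negP => e0.
set e := nrm _ in e0.
have /continuous_nrm/(_ (e / 2))[|r1 r10 h1'] := c1; first by rewrite divr_gt0.
have /continuous_nrm/(_ (e / 2))[|r2 r20 h2'] := c2; first by rewrite divr_gt0.
have /near_nrm[r3 r30 h3] := lift_infty_local.
pose r := Num.min (Num.min r1 r2) r3.
have rr : 0 < r by rewrite !lt_min r10 r20.
pose v : C := cof (r / 2).
have nv : nrm v = r / 2.
  by apply: cof_inj; rewrite -nrmE ger0_norm // -cof0 cof_le divr_ge0 // ltW.
have v0 : v != 0 by rewrite -nrm_gt0 nv divr_gt0.
have [l1 l2 l3] : [/\ nrm (v - 0) < r1, nrm (v - 0) < r2 & nrm (v - 0) < r3].
  have [q1 q2 q3] : [/\ r <= r1, r <= r2 & r <= r3].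
    by rewrite /r !ge_min !lexx !orbT.
  by rewrite subr0 nv; split; lra.
have u1 := h2' v l2; have u2 := h1' v l1.
rewrite -h3 // -revE // [eval_row (reverse p) v 0 j]mxE in u2.
have := nrmD ((reverse p 0 j).[v] - lift_infty 0 0 j)
  (- ((reverse p 0 j).[v] - (reverse p 0 j).[0])).
rewrite nrmN opprB addrC addrA subrK -/e; lra.
Qed.

End PolynomialLift.

Section BilinearForm.
Local Open Scope classical_set_scope.
Local Open Scope ring_scope.
Variables (R : realType) (b : {symmetric 'rV[cplx R]_5}).
Local Notation C := (cplx R).

Definition form_mx : 'M[C]_5 := \matrix_(i, j) b (delta_mx 0 i) (delta_mx 0 j).

Lemma form_mxE u v : form form_mx u v = b u v.
Proof.
rewrite formE [in RHS](row_sum_delta u) linear_sumlz; apply: eq_bigr => i _.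
rewrite [in RHS](row_sum_delta v) linear_sumr; apply: eq_bigr => j _.
rewrite linearZlr /= mxE; ring.
Qed.

Lemma symmetricC u v : b u v = b v u.
Proof. by rewrite [LHS]hermC /= expr0 mul1r. Qed.

Lemma form_mx_sym : form_mx^T = form_mx.
Proof. by apply/matrixP => i j; rewrite !mxE symmetricC. Qed.

Lemma form_mx_unit : nondegenerate b -> form_mx \in unitmx.
Proof.
move=> nd; rewrite -row_free_unit -kermx_eq0; apply/rowV0P => u /sub_kermxP uB.
apply/eqP; rewrite -memv0 -(eqP nd); apply/mem_orthovP => v _.
by rewrite -form_mxE /form uB mul0mx mxE.
Qed.

End BilinearForm.

(** * Immersion of the polynomial lift and conclusion *)

Section Assembly.
Local Open Scope classical_set_scope.
Local Open Scope ring_scope.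
Variable R : realType.
Local Notation C := (cplx R).
Implicit Types (z w : C) (p : 'rV[{poly C}]_5).

Lemma derive_linear_form (c : 'cV[C]_5) (G : C -> 'rV[C]_5) z :
  derivable G z 1 ->
  is_derive z 1 (fun w => (G w *m c) 0 0 : C) ((derive1 G z *m c) 0 0).
Proof.
move=> dG.
have -> : (fun w => (G w *m c) 0 0) = \sum_j (fun w => c j 0 * G w 0 j : C).
  by apply/funext => v; rewrite fct_sumE mxE; apply: eq_bigr => j _;
    rewrite mulrC.
have -> : (derive1 G z *m c) 0 0 = \sum_j c j 0 * derive1 G z 0 j.
  by rewrite mxE; apply: eq_bigr => j _; rewrite mulrC.
apply: is_derive_sum => j.
have d := derive_coord j dG; exact: is_deriveZ.
Qed.

Lemma derive1_eval_row p z : derive1 (eval_row p) z = eval_row (deriv_row p) z.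
Proof. by rewrite derive1E; have [_ ->] := derive_eval_row p z. Qed.

(** Write [P = l G] with [G] normalized by [G *m c = 1]. Then [P' = l G' + l' G] and [G' *m c = 0],
    so applying [c] to a linear relation between [P] and [P'] separates its [G'] part from its [G]
    part. *)
Lemma unbranched_free (g : P1 R -> PW R) i z p : unbranched g ->
  local_lift g i z (eval_row p) -> free2 (eval_row p z)
    (eval_row (deriv_row p) z).
Proof.
move=> ug [_ lP]; have [c [G [[hG lG] Gc dG0]]] := ug i z.
have dG := nbhs_singleton hG; have dP := derive_eval_row p z.
pose l w : C := (eval_row p w *m c) 0 0.
have PE : \forall w \near z, eval_row p w = l w *: G w.
  near=> w.
  have [Pw pw] : eval_row p w != 0 /\ line (g (chart i w)) =
    <[eval_row p w]>%VS by near: w.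
  have [Gw gw] : G w != 0 /\ line (g (chart i w)) = <[G w]>%VS by near: w.
  have [a _ E] : exists2 a, a != 0 & eval_row p w = a *: G w.
    by apply: vline_eq => //; rewrite -pw -gw.
  have G1 : G w *m c = 1%:M by near: w.
  by rewrite /l E -scalemxAl G1 !mxE mulr1.
have dl : is_derive z 1 l ((eval_row (deriv_row p) z *m c) 0 0).
  rewrite -derive1_eval_row; apply: derive_linear_form; by case: dP.
set l' := (eval_row (deriv_row p) z *m c) 0 0 in dl.
have Gc0 : (derive1 G z *m c) 0 0 = 0.
  have [_ <-] := derive_linear_form c dG.
  have E : {near z, (fun=> 1 : C) =1 (fun w => (G w *m c) 0 0)}.
    by apply: filterS Gc => w ->; rewrite mxE.
  by rewrite -(near_eq_derive _ E) derive_cst.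
have Pder : eval_row (deriv_row p) z = l z *: derive1 G z + l' *: G z.
  apply/rowP => j; rewrite !mxE.
  have := derive_horner (p 0 j) z => -[_ <-].
  have E : {near z, (fun w => l w * G w 0 j : C) =1 (fun w => (p 0 j).[w] : C)}.
    by apply: filterS PE => w /rowP/(_ j); rewrite !mxE.
  rewrite -(near_eq_derive _ E).
  have [_ ->] := is_deriveM dl (derive_coord j dG).
  by congr (_ + _); rewrite [LHS]mulrC.
have PEz := nbhs_singleton PE; have G1 := nbhs_singleton Gc.
have [Pz _] := nbhs_singleton lP.
have l0 : l z != 0 by apply: contra Pz => /eqP l0; rewrite PEz l0 scale0r.
move=> a a' E.
have e1 : a * l z + a' * l' = 0.
  have := congr1 (fun v => (v *m c) 0 0) E.
  by rewrite mul0mx mulmxDl -!scalemxAl mxE [X in X + _]mxE [X in _ + X]mxE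
    [RHS]mxE.
have e2 : (a' * l z) *: derive1 G z = 0.
  move: E; rewrite {1}PEz Pder scalerDr !scalerA addrCA -scalerDl e1 scale0r
    addr0.
  by [].
have a'0 : a' = 0.
  move/eqP: e2; rewrite scaler_eq0 (negPf dG0) orbF mulf_eq0 (negPf l0) orbF.
  by move/eqP.
split=> //; move/eqP: e1; rewrite a'0 mul0r addr0 mulf_eq0 (negPf l0) orbF.
by move/eqP.
Unshelve. all: by end_near. Qed.

Lemma local_lift_eval_row (g : P1 R -> PW R) i p :
  (forall z, eval_row p z != 0 /\ line (g (chart i z)) = <[eval_row p z]>%VS) ->
  forall z, local_lift g i z (eval_row p).
Proof.
move=> h z; split; last exact: (@filterE _ (nbhs z) _ _ h).
have d w : derivable (eval_row p) w 1 by case: (derive_eval_row p w).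
exact: (@filterE _ (nbhs z) _ _ d).
Qed.

Lemma eval_row_sum p z : (forall j, (size (p ord0 j) <= 8)%N) ->
  eval_row p z = \sum_(i < 8) z ^+ i *: coef_row p i.
Proof.
move=> sz; apply/rowP => j; rewrite mxE summxE (horner_coef_wide _ (sz j)).
by apply: eq_bigr => i _; rewrite !mxE mulrC.
Qed.

End Assembly.

Theorem proposition8 (R : realType) (b : {symmetric 'rV[cplx R]_5})
    (b_nondeg : nondegenerate b) :
  ~ exists g : P1 R -> PW R,
      [/\ null_curve b g, unbranched g, nonlinear g & has_degree g 7].
Proof.
move=> [g [[hg _ ng] ug lg [c [_ _ [s [m [us sP mP sm]]]]]]].
have [Z [k [k1 [uZ kZ km ad0 ad1]]]] := degree_data hg us sP mP.
rewrite sm in km.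
have [GH ad0'] := choice (fun z => ad0 z).
have [h0 {}ad0] := choice ad0'.
have [G1 [h1 {}ad1]] := ad1.
have [p [sz c0 c1]] := lift_charts uZ kZ km ad0 ad1.
have ll0 := local_lift_eval_row c0; have ll1 := local_lift_eval_row c1.
pose B := form_mx b.
have Bs : B^T = B := form_mx_sym b.
have Bu : B \in unitmx := form_mx_unit b_nondeg.
have np : null_poly B p.
  split=> //.
  - apply: poly_eq0 => z _; rewrite pform_eval form_mxE.
    by case: (ng _ _ _ (ll0 z)).
  - apply: poly_eq0 => z _; rewrite pform_eval form_mxE.
    by case: (ng _ _ _ (ll0 z)); rewrite derive1_eval_row.
  - by move=> z; exact: unbranched_free (ll0 z).
have gp : immersed_null B p.
  (* In the chart at infinity the lift is [reverse p], whose value and derivative at 0 are [P_7] and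
     [P_6]. *)
  split=> //; have := unbranched_free ug (ll1 0).
  by rewrite !eval_row0 coef_deriv_row scale1r !coef_reverse.
have z0 : forall i j, gram B p i j = 0.
  apply: gram_eq0_of_osc => //; first by case: (immersed_null_reverse Bs gp).
  exact: immersed_null_osc_eq0.
have sp i : exists a a', coef_row p i = a *: coef_row p 0 + a' *: coef_row p 1.
  by apply: (null_span Bs Bu np); exact: z0.
(* [L] is the tangent line at the point 0; all coefficients lie in it, so the whole curve does. *)
pose L := <<[tuple coef_row p 0; coef_row p 1]>>%VS.
have cL i : coef_row p i \in L.
  have [a [a' ->]] := sp i.
  by apply: memvD; apply/memvZ/memv_span; rewrite !inE eqxx ?orbT.
apply: lg; exists L.
  suff /eqnP : free [tuple coef_row p 0; coef_row p 1] by [].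
  apply/freeP => k'; rewrite !big_ord_recl big_ord0 addr0 => E.
  have [e0 e1] := null_free0 np E => i.
  by case: i => [[|[|i]]] hi //; [rewrite -[RHS]e0|rewrite -[RHS]e1];
    congr k'; apply: val_inj.
move=> q; have [[z ->]|->] := chart_cases q.
  have [_ ->] := c0 z; rewrite -memvE eval_row_sum //.
  by apply: memv_suml => i _; exact: memvZ.
by have [_ ->] := c1 0; rewrite -memvE eval_row0 coef_reverse.
Qed.
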